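(* The following holds for every graph $H$ with at least one edge. (1) If $H$ is not almost colour-critical, then $d_{\ell}(H) \ge \frac{\chi(H)-2}{\chi(H)-1}+ \frac{1}{(\chi(H)-1)^2(\ell-1)^2}$ for every integer $\ell \ge v(H)$. (2) If $H$ is almost colour-critical, then there exists a positive integer $C=C(H)$ such that $d_{\ell}(H)=\frac{\chi(H)-2}{\chi(H)-1}$ for every integer $\ell >C$.
   Context: All graphs are finite, simple and undirected; $v(H)$ is the number of vertices and $\chi(H)$ the chromatic number of $H$. An $\ell$-partite graph $G=(V_1\cup\ldots\cup V_\ell,E)$ is a graph whose vertex set is the disjoint union of non-empty independent sets $V_1,\ldots,V_\ell$ (its parts). The edge density between parts is $d(V_i,V_j)=\frac{e(V_i,V_j)}{|V_i||V_j|}$, where $e(V_i,V_j)$ is the number of edges between $V_i$ and $V_j$. A copy of $H$ in $G$ is a (not necessarily induced) subgraph of $G$ isomorphic to $H$. For a graph $H$ and an integer $\ell\ge v(H)$, $d_\ell(H)$ is the minimum real number such that every $\ell$-partite graph $G=(V_1\cup\ldots\cup V_\ell,E)$ with $d(V_i,V_j)>d_\ell(H)$ for all $i\ne j$ contains a copy of $H$. A graph $H$ is almost colour-critical if there exists a map $\phi:V(H)\to\{1,2,\ldots,\chi(H)-1\}$ such that (i) the subgraph of $H$ induced on $\phi^{-1}(1)$ has maximum degree at most $1$, and (ii) for $2\le i\le\chi(H)-1$, $\phi^{-1}(i)$ is an independent set of $H$. *)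

(* Defs.v *)
From HB Require Import structures.
From mathcomp Require Import all_boot all_order all_algebra.
From mathcomp Require Import all_classical all_reals.

Set Implicit Arguments.
Unset Strict Implicit.
Unset Printing Implicit Defensive.

Import Order.TTheory GRing.Theory Num.Theory.

Local Open Scope ring_scope.

Record sgraph := SGraph {
  vertex :> finType;
  adj : rel vertex;
  adj_sym : symmetric adj;
  adj_irr : irreflexive adj
}.

Definition has_edge (H : sgraph) : Prop := exists x y : H, adj x y.

Definition independent (G : sgraph) (A : {set G}) : Prop :=
  {in A &, forall x y, ~~ adj x y}.

Section Induced.
Variables (G : sgraph) (A : {set G}).

Let iadj : rel {x : G | x \in A} := fun x y => adj (val x) (val y).

Fact induced_sym : symmetric iadj.
Proof. by move=> x y; apply: adj_sym. Qed.

Fact induced_irr : irreflexive iadj.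
Proof. by move=> x; apply: adj_irr. Qed.

Definition induced : sgraph := SGraph induced_sym induced_irr.
End Induced.

Definition degree (G : sgraph) (x : G) : nat := #|[set y | adj x y]|.

Definition max_degree (G : sgraph) : nat := \max_(x : G) degree x.

Definition colourable (G : sgraph) (k : nat) : bool :=
  [exists c : {ffun G -> 'I_k}, [forall x, forall y, adj x y ==> (c x != c y)]].

Fact colourable_ex (G : sgraph) : exists k, colourable G k.
Proof.
exists #|G|; apply/existsP; exists [ffun x => enum_rank x].
apply/forallP => x; apply/forallP => y; apply/implyP => xy; rewrite !ffunE.
by apply: contraTneq xy => /enum_rank_inj ->; rewrite adj_irr.
Qed.

Definition chromatic_number (G : sgraph) : nat := ex_minn (colourable_ex G).

Definition almost_colour_critical (H : sgraph) : Prop :=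
  exists phi : H -> nat,
    [/\ forall x, (1 <= phi x <= (chromatic_number H).-1)%N,
        (max_degree (induced [set x | phi x == 1%N]) <= 1)%N
      & forall i, (2 <= i <= (chromatic_number H).-1)%N ->
          independent [set x | phi x == i]].

Definition contains_copy (G H : sgraph) : Prop :=
  exists f : H -> G, injective f /\ forall x y, adj x y -> adj (f x) (f y).

Definition multipartite (G : sgraph) (l : nat) (V : 'I_l -> {set G}) : Prop :=
  [/\ forall i, V i != finset.set0,
      forall i j, i != j -> [disjoint V i & V j],
      \bigcup_i V i = [set: G]
    & forall i, independent (V i)].

(* Ordered pairs (a, b) in A x B: each edge is counted once if A and B are
   disjoint, the only case in which this is used. *)
Definition edges_between (G : sgraph) (A B : {set G}) : nat :=
  #|[set p in finset.setX A B | adj p.1 p.2]|.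

Definition edge_density (R : realType) (G : sgraph) (A B : {set G}) : R :=
  (edges_between A B)%:R / (#|A|%:R * #|B|%:R).

Definition density_forces (R : realType) (l : nat) (H : sgraph) (d : R) : Prop :=
  forall (G : sgraph) (V : 'I_l -> {set G}), multipartite V ->
    (forall i j, i != j -> d < edge_density R (V i) (V j)) ->
    contains_copy G H.

(* The infimum is a minimum: see [partite_densityP]. *)
Definition partite_density (R : realType) (l : nat) (H : sgraph) : R :=
  inf [set d : R | density_forces l H d]%classic.

Section Minimum.
Variables (R : realType) (l : nat) (H : sgraph).

Lemma edge_density_le1 (G : sgraph) (A B : {set G}) : edge_density R A B <= 1.
Proof.
rewrite /edge_density -natrM -finset.cardsX.
have le : (edges_between A B <= #|finset.setX A B|)%N.
  by apply/subset_leq_card/fintype.subsetP => p; rewrite inE => /andP[].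
have [->|n0] := posnP #|finset.setX A B|; first by rewrite invr0 mulr0.
by rewrite ler_pdivrMr ?ltr0n // mul1r ler_nat.
Qed.

Hypotheses (l_gt1 : (1 < l)%N) (eH : has_edge H).

Lemma density_forces1 : density_forces l H (1 : R).
Proof.
move=> G V _ /(_ (Ordinal (ltnW l_gt1)) (Ordinal l_gt1) isT).
by rewrite ltNge edge_density_le1.
Qed.

Let e0 : rel 'I_l := fun _ _ => false.
Let e0_sym : symmetric e0. Proof. by []. Qed.
Let e0_irr : irreflexive e0. Proof. by []. Qed.

Lemma density_forces_ge0 (d : R) : density_forces l H d -> 0 <= d.
Proof.
move=> dF; rewrite leNgt; apply/negP => d0.
have := dF (SGraph e0_sym e0_irr) (fun i => [set i]%SET).
case=> [|i j _|f [_ fa]].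
- split=> [i|i j ij||i x y _ _].
  + by apply/finset.set0Pn; exists i; rewrite inE.
  + by rewrite disjoints1 inE.
  + by apply/finset.setP => x; rewrite inE; apply/finset.bigcupP; exists x; rewrite ?inE.
  + by [].
- by apply: (lt_le_trans d0); rewrite /edge_density mulr_ge0 ?invr_ge0 ?mulr_ge0 ?ler0n.
- by have [x [y /fa]] := eH.
Qed.

Lemma partite_densityP :
  density_forces l H (partite_density R l H) /\
  (forall d : R, density_forces l H d -> partite_density R l H <= d).
Proof.
set S := [set d : R | density_forces l H d]%classic.
have lbS : has_lbound S by exists 0 => d /density_forces_ge0.
have hi : has_inf S by split=> //; exists 1; exact: density_forces1.
split=> [G V GV dV|d dS]; last exact: ge_inf.
pose D (p : 'I_l * 'I_l) := edge_density R (V p.1) (V p.2).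
have p0P : [pred p : 'I_l * 'I_l | p.1 != p.2]
    (Ordinal (ltnW l_gt1), Ordinal l_gt1) by [].
case: (arg_minP D p0P) => p /= pP pmin.
have [|d dS dp] := @inf_lt R S (D p) _ (dV _ _ pP).
  by exists 1; exact: density_forces1.
apply: (dS G V GV) => i j ij; apply: lt_le_trans dp _.
exact: (pmin (i, j)).
Qed.
End Minimum.

(* Main.v *)
Require Import Defs.
From mathcomp Require Import all_boot all_order all_algebra.
From mathcomp Require Import all_classical all_reals.
From mathcomp Require Import ring lra zify.
From mathcomp Require Import fintype finset.

Import Order.TTheory GRing.Theory Num.Theory.

Local Open Scope ring_scope.

(** Write r = chi(H) - 1 throughout; the number of colours r is k + 1 in the
    lemmas below, so that chi(H) = k + 2.

    Lower bounds.  In [extremal_graph] every part has r colour classes, any two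
    vertices of different parts and different colours are adjacent, and (in the
    version used when H is not almost colour-critical) the vertices of the first
    colour carry one extra edge between any two parts, these edges forming a
    matching.  A copy of H would be r-colourable, or would inherit a colouring
    whose first class has maximum degree at most 1; both are excluded.

    Upper bound.  Let H be almost colour-critical and let G be an H-free
    l-partite graph, l large, with all densities above 1 - 1/r.  Give each part
    total weight 1, spread uniformly.
    - G contains no large complete (r+1)-partite graph, hence has almost no
      weight on (r+1)-cliques ([clique_mass_blowup]).  Its average density is
      about 1 - 1/r, so a weighted stability theorem
      ([clique_mass_stability]) yields an r-colouring with few edges inside
      the classes and, by counting, few non-edges between them.
    - Only boundedly many vertices have many neighbours in all r classes: many
      such vertices would have a rich common neighbourhood and give a complete
      (r+1)-partite graph.  Discarding the parts that meet these vertices and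
      recolouring, every vertex has few neighbours in its own class
      ([near_partite_colouring]).
    - For a part i let q_i be the vector of class weights of i, minus 1/r in
      each coordinate.  A positive fraction of the parts have the same sign
      pattern of q_i, hence pairwise inner products <q_i, q_j> >= 0.  Keep
      only these.
    - Call a vertex typical if it is adjacent to nearly all of the other
      classes.  A large matching of edges inside a class between typical
      vertices extends to a copy of H ([typical_matching_copy]).  Otherwise
      boundedly many vertices cover these edges, and dropping their parts
      leaves parts in which every edge inside a class has an atypical end.
    - The density between two remaining parts is
      1 - 1/r - <q_i, q_j> - missing + inner, where inner counts the edges
      inside the classes and missing the non-edges between different classes.
      Being above 1 - 1/r, it forces inner > missing for every pair of parts.
      But an atypical vertex misses far more than it has inner edges, so in
      total inner <= missing ([inner_le_missing_absurd]).

    The strict inequality on the densities enters in this last step, which is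
    exact: nothing of order 1/l is lost, and so the bound 1 - 1/r holds for
    finite l. *)

Set Implicit Arguments.
Unset Strict Implicit.
Unset Printing Implicit Defensive.

(** * Weighted cliques *)

Lemma le_of_eq (R : realType) (a b : R) : a = b -> a <= b.
Proof. by move=> ->. Qed.

Section Density.
Variables (R : realType) (G : sgraph).
Implicit Types (mu : G -> R) (B S Y : {set G}) (x y : G).

Definition nbr x : {set G} := [set y | adj x y].
Definition common_nbr S : {set G} := [set y | [forall x in S, adj x y]].

(** The total weight of the ordered k-cliques inside B, peeled off one vertex at
    a time so that inductions on k need no sums over tuples. *)
Fixpoint clique_mass mu k B : R :=
  if k is k'.+1 then \sum_(x in B) mu x * clique_mass mu k' (B :&: nbr x) else 1.

Definition weighting mu := (forall x, 0 <= mu x) /\ \sum_x mu x <= 1.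

(** A complete k-partite subgraph of B with classes of size m, one class peeled
    off at a time; the classes are disjoint because adjacency is irreflexive. *)
Fixpoint blowup k m B : Prop :=
  if k is k'.+1 then
    exists S : {set G}, [/\ S \subset B, #|S| = m & blowup k' m (B :&: common_nbr S)]
  else True.

Variable mu : G -> R.
Hypothesis mu_ge0 : forall x, 0 <= mu x.

Lemma clique_mass_ge0 k B : 0 <= clique_mass mu k B.
Proof.
elim: k B => [|k IH] B //=.
by apply: sumr_ge0 => x _; apply: mulr_ge0.
Qed.

Lemma clique_mass_le1 k B : \sum_x mu x <= 1 -> clique_mass mu k B <= 1.
Proof.
move=> mu1; elim: k B => [|k IH] B //=.
apply: le_trans mu1; rewrite [leRHS](bigID (mem B)) /= -[leLHS]addr0.
apply: lerD; last exact: sumr_ge0.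
by apply: ler_sum => x _; rewrite -[leRHS]mulr1 ler_wpM2l.
Qed.

(** A k-clique of B lying in fewer than m of the neighbourhoods of Y is paid for
    by the first term.  Any other clique lies in the common neighbourhood of some
    m-subset of Y, and it is counted at most #|Y| times on the left. *)
Lemma sum_clique_mass_common k m n B Y : (#|Y| <= n)%N ->
  \sum_(x in Y) clique_mass mu k (B :&: nbr x) <=
    m%:R * clique_mass mu k B +
    n%:R * \sum_(S : {set G} | (S \subset Y) && (#|S| == m))
             clique_mass mu k (B :&: common_nbr S).
Proof.
elim: k B Y => [|k IH] B Y leYn /=.
  rewrite sumr_const mulr1; have [leYm|ltmY] := leqP #|Y| m.
    by rewrite -[leLHS]addr0 lerD ?ler_nat // mulr_ge0 // sumr_ge0.
  have [S SY cS] : exists2 S : {set G}, S \subset Y & #|S| = m.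
    exists [set x in take m (enum Y)].
      by apply/subsetP => x; rewrite inE => /mem_take; rewrite mem_enum.
    rewrite cardsE; have /card_uniqP -> : uniq (take m (enum Y)).
      exact: take_uniq (enum_uniq _).
    by rewrite size_take -cardE ltmY.
  rewrite -[leLHS]add0r lerD ?ler0n // (bigD1 S) /=; last by rewrite SY cS eqxx.
  rewrite mulrDr mulr1 -[leLHS]addr0 lerD ?ler_nat //.
  by rewrite mulr_ge0 // sumr_ge0.
have -> : \sum_(x in Y) \sum_(y in B :&: nbr x)
              mu y * clique_mass mu k (B :&: nbr x :&: nbr y) =
          \sum_(y in B) mu y *
             \sum_(x in Y :&: nbr y) clique_mass mu k (B :&: nbr y :&: nbr x).
  under eq_bigr => x _ do under eq_bigl => y do rewrite in_setI.
  under eq_bigr => x _ do rewrite big_mkcondr.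
  rewrite exchange_big /=; apply: eq_bigr => y _.
  under [in RHS]eq_bigl => x do rewrite in_setI.
  rewrite -big_mkcondr mulr_sumr; apply: eq_big => x.
    by rewrite !inE adj_sym.
  by rewrite setIAC.
have step y : y \in B -> mu y *
     \sum_(x in Y :&: nbr y) clique_mass mu k (B :&: nbr y :&: nbr x) <=
   m%:R * (mu y * clique_mass mu k (B :&: nbr y)) +
   n%:R * \sum_(S : {set G} | (S \subset Y) && (#|S| == m))
     if y \in common_nbr S then
     mu y * clique_mass mu k (B :&: common_nbr S :&: nbr y) else 0.
  move=> _; rewrite mulrCA [in X in _ + X]mulrC -big_mkcondr -mulr_sumr.
  rewrite -mulrA -mulrDr ler_wpM2l //.
  have := IH (B :&: nbr y) (Y :&: nbr y) (leq_trans (subset_leq_card (subsetIl _ _)) leYn).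
  move/le_trans; apply; rewrite lerD2l [leRHS]mulrC ler_wpM2l //.
  apply: le_of_eq; apply: eq_big => S; last by rewrite setIAC.
  rewrite subsetI -!andbA; congr (_ && _); rewrite andbC inE; congr (_ && _).
  apply/subsetP/forall_inP => h x xS; move: (h x xS); by rewrite inE adj_sym.
apply: le_trans; first by apply: ler_sum => y; exact: step.
rewrite big_split /= -!mulr_sumr exchange_big /=.
rewrite lerD2l ler_wpM2l //; apply: ler_sum => S _; rewrite -big_mkcondr.
by apply: le_of_eq; apply: eq_bigl => y; rewrite in_setI.
Qed.

End Density.

Lemma exists_nat_mul_gt (R : realType) (a b : R) : 0 < b -> exists n : nat, (0 < n)%N /\ a < n%:R * b.
Proof.
move=> b0; exists (Num.truncn `|a / b|).+1; split=> //.
by rewrite -ltr_pdivrMr // (le_lt_trans (ler_norm _)) // truncnS_gt.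
Qed.

(** Of N sets of density eta, some m meet in positive density: the bound above
    leaves weight for the m-subsets, and a subset of Y of size N has at most
    2 ^ N of them. *)
Lemma common_nbr_clique_mass (R : realType) (k m : nat) (eta : R) : 0 < eta ->
  exists (N : nat) (eta' : R), [/\ (0 < N)%N, 0 < eta' &
  forall (G : sgraph) (mu : G -> R) (B Y : {set G}), weighting mu ->
    (N <= #|Y|)%N -> (forall x, x \in Y -> eta <= clique_mass mu k (B :&: nbr x)) ->
  exists S : {set G}, [/\ S \subset Y, #|S| = m &
    eta' <= clique_mass mu k (B :&: common_nbr S)]].
Proof.
move=> eta0; have e20 : 0 < eta / 2 by lra.
have [N [N0 ltN]] := exists_nat_mul_gt (2 * m%:R) eta0.
exists N, (eta / 2 / (2 ^ N)%:R).
have p0 : 0 < (2 ^ N)%:R :> R by rewrite ltr0n expn_gt0.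
split=> // [|G mu B Y [mu0 mu1] leNY YP].
  by rewrite !divr_gt0 // ltr0n.
have [Y' Y'Y cY'] : exists2 S : {set G}, S \subset Y & #|S| = N.
  exists [set x in take N (enum Y)].
    by apply/subsetP => x; rewrite inE => /mem_take; rewrite mem_enum.
  rewrite cardsE; have /card_uniqP -> : uniq (take N (enum Y)).
    exact: take_uniq (enum_uniq _).
  by rewrite size_takel -?cardE.
apply: contrapT => nS.
have small (S : {set G}) : (S \subset Y') && (#|S| == m) ->
    clique_mass mu k (B :&: common_nbr S) <= eta / 2 / (2 ^ N)%:R.
  case/andP=> SY /eqP cS; rewrite leNgt; apply/negP => lt; apply: nS.
  by exists S; rewrite (subset_trans SY) // ltW.
have := sum_clique_mass_common mu0 k m B (eq_leq cY').
have : N%:R * eta <= \sum_(x in Y') clique_mass mu k (B :&: nbr x).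
  rewrite -cY' mulrC mulr_natr -sumr_const; apply: ler_sum => x xY'.
  by apply: YP; apply: (subsetP Y'Y).
have : m%:R * clique_mass mu k B <= m%:R.
  by rewrite -[leRHS]mulr1 ler_wpM2l // clique_mass_le1.
have : \sum_(S : {set G} | (S \subset Y') && (#|S| == m))
    clique_mass mu k (B :&: common_nbr S) <= eta / 2.
  apply: le_trans; first by apply: ler_sum => S; exact: small.
  rewrite sumr_const -[leLHS]mulr_natr mulrAC ler_pdivrMr // ler_wpM2l ?(ltW e20) //.
  rewrite ler_nat -cY' -card_powerset; apply/subset_leq_card/subsetP => S.
  by rewrite powersetE unfold_in => /andP[].
set s := \sum_(S | _) _ => sle le1 le2 le3.
have le4 : N%:R * s <= N%:R * (eta / 2) by rewrite ler_wpM2l.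
lra.
Qed.

(** Supersaturation: positive clique density forces a complete multipartite
    graph.  A positive weight of vertices x have positive (k-1)-clique density in
    their neighbourhood.  As single vertices weigh little there are many such x,
    so m of them have a common neighbourhood rich in (k-1)-cliques. *)
Lemma clique_mass_blowup (R : realType) (k m : nat) (eta : R) : 0 < eta ->
  exists alpha : R, 0 < alpha /\ forall (G : sgraph) (mu : G -> R) (B : {set G}),
    weighting mu -> (forall x, mu x <= alpha) -> eta <= clique_mass mu k B ->
    blowup k m B.
Proof.
elim: k eta => [|k IH] eta eta0; first by exists 1.
have e20 : 0 < eta / 2 by lra.
have [N [eta' [N0 eta'0 NP]]] := common_nbr_clique_mass k m e20.
have [alpha [alpha0 alphaP]] := IH _ eta'0.
exists (Num.min alpha (eta / (2 * N%:R))).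
have N0R : 0 < N%:R :> R by rewrite ltr0n.
split=> [|G mu B wmu muA]; first by rewrite lt_min alpha0 divr_gt0 // mulr_gt0.
have [mu0 mu1] := wmu => /= etaB.
(* Averaging: the vertices outside Y contribute at most eta / 2. *)
pose Y := [set x in B | eta / 2 <= clique_mass mu k (B :&: nbr x)].
have massY : eta / 2 <= \sum_(x in Y) mu x.
  have : \sum_(x in B) mu x * clique_mass mu k (B :&: nbr x) <=
         \sum_(x in Y) mu x + eta / 2 * \sum_x mu x.
    rewrite mulr_sumr big_mkcond [\sum_(x in Y) _]big_mkcond -big_split /=.
    apply: ler_sum => x _; rewrite inE; case: (x \in B) => /=.
      have c1 := clique_mass_le1 mu0 k (B :&: nbr x) mu1.
      have := mu0 x => m0; case: (leP (eta / 2)) => h.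
        have : mu x * clique_mass mu k (B :&: nbr x) <= mu x * 1 by rewrite ler_wpM2l.
        have : 0 <= eta / 2 * mu x by rewrite mulr_ge0 // ltW.
        lra.
      by rewrite add0r mulrC ler_wpM2r // ltW.
    by rewrite add0r mulr_ge0 // ltW.
  have : eta / 2 * \sum_x mu x <= eta / 2 * 1 by rewrite ler_wpM2l // ltW.
  lra.
have cY : (N <= #|Y|)%N.
  rewrite -(ler_nat R); have : \sum_(x in Y) mu x <= #|Y|%:R * (eta / (2 * N%:R)).
    rewrite mulr_natl -sumr_const; apply: ler_sum => x _.
    by apply: le_trans (muA x) _; rewrite ge_min lexx orbT.
  move/(le_trans massY); rewrite mulrA ler_pdivlMr ?mulr_gt0 //.
  have -> : eta / 2 * (2 * N%:R) = eta * N%:R by lra.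
  by rewrite [leRHS]mulrC ler_pM2l.
have [|S [SY cS etaS]] := NP G mu B Y wmu cY.
  by move=> x; rewrite inE => /andP[].
exists S; split=> //; first by apply: subset_trans SY _; apply/subsetP => x; rewrite inE => /andP[].
apply: (alphaP G mu) => // x; apply: le_trans (muA x) _.
by rewrite ge_min lexx.
Qed.

(** * Cliques across near-complete classes, and stability *)

(** Heavy classes with almost no weight of non-edges between them span cliques:
    a weight eps / 2 of the first class misses little of the others, and inside the
    neighbourhood of such a vertex the remaining classes keep weight eps / 2. *)
Lemma clique_mass_classes (R : realType) (k : nat) (eps : R) : 0 < eps ->
  exists gam eta : R, [/\ 0 < gam, 0 < eta &
  forall (G : sgraph) (mu : G -> R) (col : G -> nat) (B : {set G}) (s : seq nat),
    weighting mu -> size s = k -> uniq s ->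
    (forall c, c \in s -> eps <= \sum_(x in B | col x == c) mu x) ->
    \sum_(x in B) \sum_(y in B)
       mu x * mu y * ((col x != col y) && ~~ adj x y)%:R <= gam ->
    eta <= clique_mass mu k B].
Proof.
elim: k eps => [|k IH] eps eps0; first by exists 1, 1.
have e20 : 0 < eps / 2 by lra.
have [gam' [eta' [gam'0 eta'0 gamP]]] := IH _ e20.
exists (Num.min gam' (eps / 2 * (eps / 2))), (eps / 2 * eta'); split.
- by rewrite lt_min gam'0 mulr_gt0.
- by rewrite mulr_gt0.
move=> G mu col B [//|c s] wmu /= [szs] /andP[cs us] classP.
have [mu0 mu1] := wmu.
rewrite le_min => /andP[mis1 mis2].
pose mis x := \sum_(y in B) mu y * ((col x != col y) && ~~ adj x y)%:R.
have mis_ge0 x : 0 <= mis x by apply: sumr_ge0 => y _; rewrite mulr_ge0.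
have misE : \sum_(x in B) \sum_(y in B)
       mu x * mu y * ((col x != col y) && ~~ adj x y)%:R = \sum_(x in B) mu x * mis x.
  by apply: eq_bigr => x _; rewrite mulr_sumr; apply: eq_bigr => y _; rewrite mulrA.
(* Vertices with large [mis] have small total weight, by Markov's inequality. *)
have massT : eps / 2 <= \sum_(x in B | (col x == c) && (mis x <= eps / 2)) mu x.
  have lec := classP c (mem_head _ _).
  have : \sum_(x in B | (col x == c)) mu x * (eps / 2) <=
     \sum_(x in B | (col x == c) && (mis x <= eps / 2)) mu x * (eps / 2) +
     \sum_(x in B) mu x * mis x.
    rewrite big_mkcondr [\sum_(x in B | _ && _) _]big_mkcondr -big_split /=.
    apply: ler_sum => x _; case: (col x == c) => /=; last by rewrite add0r mulr_ge0.
    case: (leP (mis x)) => h; first by rewrite lerDl mulr_ge0.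
    by rewrite add0r ler_wpM2l // ltW.
  rewrite -!mulr_suml -misE => h.
  have : (\sum_(x in B | col x == c) mu x) * (eps / 2) <=
     (\sum_(x in B | (col x == c) && (mis x <= eps / 2)) mu x + eps / 2) * (eps / 2) by lra.
  by rewrite ler_pM2r //; lra.
apply: le_trans (_ : \sum_(x in B | (col x == c) && (mis x <= eps / 2)) mu x * eta' <= _).
  by rewrite -mulr_suml ler_pM2r.
rewrite big_mkcondr; apply: ler_sum => x xB; case: ifP => [/andP[/eqP cx misx]|_]; last first.
  by rewrite mulr_ge0 // clique_mass_ge0.
rewrite ler_wpM2l //; apply: (gamP G mu col _ s) => //.
  move=> d ds; have dc : c != d by apply: contraNneq cs => ->.
  have : \sum_(y in B | col y == d) mu y <=
         \sum_(y in B :&: nbr x | col y == d) mu y + mis x.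
    rewrite big_mkcondr [\sum_(y in _ :&: _ | _) _]big_mkcondr.
    under [X in _ <= X + _]eq_bigl => y do rewrite in_setI.
    rewrite [X in _ <= X + _]big_mkcondr -big_split /=.
    apply: ler_sum => y _; rewrite inE cx; case: eqP => [->|_].
      by rewrite dc; case: (adj x y) => /=; rewrite ?mulr0 ?mulr1 ?addr0 ?add0r.
    by case: ifP; rewrite add0r mulr_ge0.
  have := classP d; rewrite inE ds orbT => /(_ isT); lra.
apply: le_trans mis1; rewrite big_mkcond [leRHS]big_mkcond.
apply: ler_sum => y _; rewrite in_setI; case: (y \in B) => //=.
have le0 z : 0 <= mu y * mu z * ((col y != col z) && ~~ adj y z)%:R.
  by rewrite !mulr_ge0.
case: ifP => _; last exact: sumr_ge0.
rewrite big_mkcond [leRHS]big_mkcond; apply: ler_sum => z _.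
by rewrite in_setI; case: (z \in B) => //=; case: ifP.
Qed.

(** Stability of Turan's theorem in degree-majorization form: edges inside a class
    are counted twice on the left, so near-extremal density leaves few of them.
    Let x1 have the largest degree among the vertices whose neighbourhood N has
    few (k+1)-cliques, and give the non-neighbours A of x1 a new colour.  The
    degrees over A are at most d(x1), except on a set of small weight, so the
    edges meeting A, counted twice inside A, contribute at most 2 |A| |N|;
    induction applies to N. *)
Lemma clique_mass_stability (R : realType) (k : nat) (eps : R) : 0 < eps ->
  exists eta : R, 0 < eta /\
  forall (G : sgraph) (mu : G -> R) (B : {set G}),
    weighting mu -> clique_mass mu k.+2 B <= eta ->
  exists col : G -> nat, (forall x, (col x < k.+1)%N) /\
    \sum_(x in B) \sum_(y in B)
       mu x * mu y * ((adj x y)%:R * (1 + (col x == col y)%:R)) <=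
    (1 - k.+1%:R^-1) * (\sum_(x in B) mu x) ^+ 2 + eps.
Proof.
elim: k eps => [|k IH] eps eps0.
  exists (eps / 2); split=> [|G mu B [mu0 mu1] /= small]; first by lra.
  exists (fun=> 0%N); split=> //; rewrite invr1 subrr mul0r add0r.
  apply: le_trans (_ : 2 * (eps / 2) <= _); last by lra.
  apply: le_trans (_ : 2 * (\sum_(x in B) mu x * \sum_(y in B :&: nbr x) mu y * 1) <= _); last first.
    by rewrite ler_pM2l.
  rewrite mulr_sumr; apply: ler_sum => x _; rewrite mulrCA mulr_sumr mulr_sumr.
  under [leRHS]eq_bigl => y do rewrite in_setI.
  rewrite [leRHS]big_mkcondr; apply: ler_sum => y _.
  rewrite inE eqxx mulr1; case: (adj x y); rewrite /= ?mul0r ?mulr0 //.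
  by rewrite mul1r mulrC mulrCA mulrA.
have e20 : 0 < eps / 2 by lra.
have [eta' [eta'0 etaP]] := IH _ e20.
exists (eta' * (eps / 4)); split=> [|G mu B wmu small].
  by rewrite mulr_gt0 //; lra.
have [mu0 mu1] := wmu.
set M := \sum_(x in B) mu x.
pose light x := clique_mass mu k.+2 (B :&: nbr x) <= eta'.
have heavy : \sum_(x in B | ~~ light x) mu x <= eps / 4.
  rewrite -(ler_pM2l eta'0); apply: le_trans small.
  rewrite [leRHS]/= mulr_sumr big_mkcondr; apply: ler_sum => x _.
  case: ifP => [|_]; last by apply: mulr_ge0 => //; apply: (clique_mass_ge0 mu0 k.+2).
  by rewrite mulrC -ltNge => /ltW h; rewrite ler_wpM2l.
have r0 : 0 <= 1 - k.+2%:R^-1 :> R by rewrite subr_ge0 invf_le1 ?ler1n ?ltr0n.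
pose d x := \sum_(y in B) mu y * (adj x y)%:R.
have d_le1 x : d x <= 1.
  apply: le_trans mu1; rewrite /d big_mkcond; apply: ler_sum => y _.
  case: ifP => // _; rewrite -[leRHS]mulr1 ler_wpM2l // lern1; by case: adj.
have [x0 /andP[x0B x0l]|nolight] := pickP (fun x => (x \in B) && light x); last first.
  exists (fun=> 0%N); split=> //.
  have ME : M <= eps / 4.
    apply: le_trans heavy; rewrite big_mkcondr; apply: ler_sum => x xB.
    by have := nolight x; rewrite xB /= => ->.
  apply: le_trans (_ : 2 * M <= _); last first.
    have : 0 <= (1 - k.+2%:R^-1) * M ^+ 2 by rewrite mulr_ge0 // sqr_ge0.
    set q := _ * M ^+ 2; lra.
  rewrite mulr_sumr; apply: ler_sum => x _.
  have := d_le1 x => h; apply: le_trans (_ : 2 * mu x * d x <= _); last first.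
    by rewrite -[leRHS]mulr1 ler_wpM2l // mulr_ge0.
  rewrite mulr_sumr; apply: ler_sum => y _; rewrite eqxx; apply: le_of_eq => /=; ring.
pose x1 := [arg max_(x > x0 | (x \in B) && light x) d x]%O.
have [x1B x1l x1max] : [/\ x1 \in B, light x1 &
    forall x, x \in B -> light x -> d x <= d x1].
  rewrite /x1; case: arg_maxP => [|x /andP[xB xl] xmax]; first by rewrite x0B.
  by split=> // y yB yl; apply: xmax; rewrite yB.
have [col' [col'P col'S]] := etaP G mu (B :&: nbr x1) wmu x1l.
pose col x := if x \in nbr x1 then col' x else k.+1.
exists col; split.
  rewrite /col; by move=> x; case: ifP => // _; rewrite ltnS ltnW.
pose a := \sum_(x in B | x \notin nbr x1) mu x.
have d1E : \sum_(x in B :&: nbr x1) mu x = d x1.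
  under eq_bigl => y do rewrite in_setI.
  rewrite big_mkcondr; apply: eq_bigr => y _; rewrite inE.
  by case: adj; rewrite ?mulr1 ?mulr0.
have ME : M = a + d x1.
  rewrite /M /a (bigID (mem (nbr x1))) /= addrC -d1E; congr (_ + _).
  by apply: eq_bigl => y; rewrite in_setI.
have sumA : \sum_(x in B | x \notin nbr x1) mu x * d x <= a * d x1 + eps / 4.
  apply: le_trans (_ : a * d x1 + \sum_(x in B | ~~ light x) mu x <= _); last by rewrite lerD2l.
  rewrite /a mulr_suml big_mkcondr [X in X + _]big_mkcondr [X in _ + X]big_mkcondr.
  rewrite -big_split /=; apply: ler_sum => x xB.
  have d0 z : 0 <= d z by apply: sumr_ge0 => y _; rewrite mulr_ge0.
  case: ifP => _; last by case: ifP; rewrite add0r.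
  case: ifP => [_|/negbFE lx]; last by rewrite addr0 ler_wpM2l // x1max.
  have : mu x * d x <= mu x * 1 by rewrite ler_wpM2l.
  have : 0 <= mu x * d x1 by rewrite mulr_ge0.
  lra.
(* Pointwise: pairs inside N keep their colours, pairs meeting A are counted once
   for each end in A. *)
have key : \sum_(x in B) \sum_(y in B)
    mu x * mu y * ((adj x y)%:R * (1 + (col x == col y)%:R)) <=
  \sum_(x in B :&: nbr x1) \sum_(y in B :&: nbr x1)
    mu x * mu y * ((adj x y)%:R * (1 + (col' x == col' y)%:R)) +
  2 * \sum_(x in B | x \notin nbr x1) mu x * d x.
  have -> : 2 * (\sum_(x in B | x \notin nbr x1) mu x * d x) =
     \sum_(x in B) \sum_(y in B) mu x * mu y * ((x \notin nbr x1)%:R * (adj x y)%:R) +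
     \sum_(x in B) \sum_(y in B) mu x * mu y * ((y \notin nbr x1)%:R * (adj x y)%:R).
    rewrite [X in _ + X]exchange_big /= mulr_natl mulr2n; congr (_ + _).
      rewrite big_mkcondr; apply: eq_bigr => x _; case: ifP => _.
        by rewrite mulr_sumr; apply: eq_bigr => y _; rewrite mul1r mulrA.
      by rewrite big1 // => y _; rewrite mul0r mulr0.
    rewrite big_mkcondr; apply: eq_bigr => x _; case: ifP => _.
      by rewrite mulr_sumr; apply: eq_bigr => y _; rewrite mul1r mulrA adj_sym [mu y * _]mulrC.
    by rewrite big1 // => y _; rewrite mul0r mulr0.
  have -> : \sum_(x in B :&: nbr x1) \sum_(y in B :&: nbr x1)
      mu x * mu y * ((adj x y)%:R * (1 + (col' x == col' y)%:R)) =
    \sum_(x in B) \sum_(y in B) mu x * mu y *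
      ((x \in nbr x1)%:R * (y \in nbr x1)%:R *
       ((adj x y)%:R * (1 + (col' x == col' y)%:R))).
    under eq_bigl => x do rewrite in_setI.
    rewrite big_mkcondr; apply: eq_bigr => x _; case: ifP => _; last first.
      by rewrite big1 // => y _; rewrite !mul0r mulr0.
    under eq_bigl => y do rewrite in_setI.
    rewrite big_mkcondr; apply: eq_bigr => y _; case: ifP => _.
      by rewrite !mul1r.
    by rewrite mulr0 mul0r mulr0.
  rewrite -!big_split /=; apply: ler_sum => x _; rewrite -!big_split /=.
  apply: ler_sum => y _; rewrite -!mulrDr ler_wpM2l ?mulr_ge0 // /col.
  case: (x \in nbr x1); case: (y \in nbr x1) => /=;
    rewrite ?mul1r ?mul0r ?addr0 ?add0r //.
  - by rewrite (ltn_eqF (col'P x)) addr0 mulr1.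
  - by rewrite eq_sym (ltn_eqF (col'P y)) addr0 mulr1.
  - by rewrite eqxx mulrDr mulr1.
apply: le_trans key _; apply: le_trans (lerD col'S (lexx _)) _.
rewrite d1E -/M ME; set q : R := k.+1%:R.
have qE : k.+2%:R = q + 1 by rewrite /q -[in RHS](natrD _ k.+1 1) addn1.
rewrite qE; have q0 : 0 < q by rewrite ltr0n.
(* The slack is a square, zero when A has the weight of one of q + 1 equal classes. *)
have : (1 - (q + 1)^-1) * (a + d x1) ^+ 2 - ((1 - q^-1) * d x1 ^+ 2 + 2 * (a * d x1))
   = (q * a - d x1) ^+ 2 / (q * (q + 1)) by field; lra.
have : 0 <= (q * a - d x1) ^+ 2 / (q * (q + 1)).
  by rewrite divr_ge0 ?sqr_ge0 // mulr_ge0; lra.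
move: sumA; set W := a * d x1; set Q := _ ^+ 2 / _; set U := _ * (_ + _) ^+ 2.
set V := _ * d x1 ^+ 2; set S := \sum_(x in B | _) _.
lra.
Qed.

(** * Finding copies of H *)

Lemma contains_copyI (G H : sgraph) (phi : H -> nat) (g : H -> G) :
  (forall x y, phi x != phi y -> adj (g x) (g y)) ->
  (forall x y, phi x = phi y -> g x = g y -> x = y) ->
  (forall x y, phi x = phi y -> adj x y -> adj (g x) (g y)) ->
  contains_copy G H.
Proof.
move=> cross inj edge; exists g; split=> [x y gxy|x y xy].
  apply: inj (gxy); apply: contra_eq gxy => /cross.
  by apply: contraTneq => ->; rewrite adj_irr.
by have [/edge|/cross] := eqVneq (phi x) (phi y); apply.
Qed.

Lemma blowup_parts (G : sgraph) (k m : nat) (B : {set G}) : blowup k m B ->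
  exists F : nat -> {set G},
    (forall c, (c < k)%N -> F c \subset B /\ #|F c| = m) /\
    (forall c d x y, (c < k)%N -> (d < k)%N -> c != d ->
       x \in F c -> y \in F d -> adj x y).
Proof.
elim: k B => [|k IH] B /=; first by exists (fun=> finset.set0).
move=> [S [SB cS /IH[F [F1 F2]]]].
have FS c x y : (c < k)%N -> x \in F c -> y \in S -> adj x y.
  move=> /F1[/subsetP FB _] /FB; rewrite !inE => /andP[_ /forall_inP h] /h.
  by rewrite adj_sym.
exists (fun c => if c == k then S else F c); split.
  move=> c; rewrite ltnS leq_eqVlt; case: eqP => [_ _|_ /= /F1[FB cF]] //.
  by split=> //; apply: subset_trans FB (subsetIl _ _).
move=> c d x y; rewrite !ltnS [(c <= k)%N]leq_eqVlt [(d <= k)%N]leq_eqVlt.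
case: eqP => [->|_] /=; case: eqP => [->|_] //=; first by rewrite eqxx.
- by move=> _ dk _ xS yF; rewrite adj_sym; apply: FS yF xS.
- by move=> ck _ _; apply: FS.
- exact: F2.
Qed.

Lemma contains_copy_blowup (G H : sgraph) (k : nat) (B : {set G}) :
  has_edge H -> colourable H k -> blowup k #|H| B -> contains_copy G H.
Proof.
move=> [h0 _] /existsP[c cP] /blowup_parts[F [F1 F2]].
have /card_gt0P[x0 _] : (0 < #|F (c h0)|)%N.
  by have [_ ->] := F1 _ (ltn_ord (c h0)); apply/card_gt0P; exists h0.
pose g h := nth x0 (enum (F (c h))) (enum_rank h).
have sz h (h' : H) : (enum_rank h' < size (enum (F (c h))))%N.
  by rewrite -cardE; have [_ ->] := F1 _ (ltn_ord (c h)); exact: ltn_ord.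
have gF h : g h \in F (c h) by rewrite -mem_enum mem_nth.
apply: (@contains_copyI G H (fun h => c h : nat) g).
- by move=> x y cxy; apply: (F2 (c x) (c y)).
- move=> x y cxy /eqP; rewrite /g -cxy nth_uniq ?enum_uniq ?sz //.
  by move=> /eqP/val_inj/enum_rank_inj.
- move=> x y cxy xy; move/forallP/(_ x)/forallP/(_ y)/implyP/(_ xy): cP.
  by move/eqP: cxy; rewrite val_eqE => ->.
Qed.

(** The vertices of a maximal matching cover all edges. *)
Lemma matching_or_cover (T : finType) (e : rel T) (m : nat) : irreflexive e ->
  (exists s : seq (T * T), [/\ size s = m, uniq (unzip1 s ++ unzip2 s) &
     forall p, p \in s -> e p.1 p.2]) \/
  (exists W : {set T}, (#|W| <= 2 * m)%N /\
     forall x y, e x y -> (x \in W) || (y \in W)).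
Proof.
move=> irr; elim: m => [|m [[s [szs us es]]|[W [cW WP]]]]; first by left; exists [::].
  pose W := [set x in unzip1 s ++ unzip2 s].
  have [/existsP[x /existsP[y /and3P[exy xW yW]]]|no] :=
      boolP [exists x, [exists y, [&& e x y, x \notin W & y \notin W]]].
    left; exists ((x, y) :: s); split; first by rewrite /= szs.
      move: xW yW; rewrite !inE !mem_cat !negb_or => /andP[x1 x2] /andP[y1 y2].
      have xy : x != y by apply: contraTneq exy => ->; rewrite irr.
      rewrite /unzip1 /unzip2 !map_cons cat_cons cons_uniq uniq_catC cat_cons cons_uniq.
      by rewrite !mem_cat inE !negb_or xy x1 x2 y1 y2 uniq_catC.
    by move=> p; rewrite inE => /orP[/eqP-> //|/es].
  right; exists W; split.
    rewrite /W cardsE; apply: leq_trans (card_size _) _.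
    by rewrite size_cat !size_map szs; lia.
  move=> x y exy; apply: contraNT no; rewrite negb_or => /andP[xW yW].
  by apply/existsP; exists x; apply/existsP; exists y; rewrite exy xW.
by right; exists W; split=> //; apply: leq_trans cW _; rewrite leq_mul2l leqnSn.
Qed.

(** The first class of the colouring of H induces single edges and single vertices.
    It is embedded into the matching s, a pair of mates sharing the edge indexed
    by the smaller of their ranks; the other classes go to the classes of the
    complete multipartite graph in the common neighbourhood. *)
Lemma contains_copy_matching (G H : sgraph) (k : nat) (s : seq (G * G)) :
  has_edge H -> almost_colour_critical H -> chromatic_number H = k.+2 ->
  size s = #|H| -> uniq (unzip1 s ++ unzip2 s) ->
  (forall p, p \in s -> adj p.1 p.2) ->
  blowup k #|H| (common_nbr [set x in unzip1 s ++ unzip2 s]) ->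
  contains_copy G H.
Proof.
move=> [h0 _] [phi [phi1 phi2 phi3]] chi szs us es /blowup_parts[F [F1 F2]].
rewrite chi /= in phi1 phi3.
set p := unzip1 s ++ unzip2 s in us F1.
have szp : size p = (#|H| + #|H|)%N by rewrite size_cat !size_map szs.
have rk (h : H) : (enum_rank h < #|H|)%N by exact: ltn_ord.
have [x0 _] : exists x0 : G, True.
  have : (0 < #|H|)%N by apply/card_gt0P; exists h0.
  by rewrite -szs; case: (s) => [|[a b] ?] //; exists a.
have class1_uniq x y z : phi x = 1%N -> phi y = 1%N -> phi z = 1%N ->
    adj x y -> adj x z -> y = z.
  move=> px py pz xy xz; set A := [set x | phi x == 1%N] in phi2.
  have mA u : phi u = 1%N -> u \in A by rewrite inE => ->.
  pose X : induced A := exist _ x (mA _ px).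
  pose Y : induced A := exist _ y (mA _ py).
  pose Z : induced A := exist _ z (mA _ pz).
  apply/eqP; apply: contraLR phi2 => yz; rewrite -ltnNge.
  apply: leq_trans (leq_bigmax X); rewrite /degree.
  have <- : #|[set Y; Z]| = 2%N by rewrite cards2 -val_eqE /= yz.
  apply/subset_leq_card/subsetP => u; rewrite !inE => /orP[] /eqP ->; exact.
pose mate h := odflt h [pick h' | (phi h' == 1%N) && adj h h'].
have mateE h h' : phi h = 1%N -> phi h' = 1%N -> adj h h' -> mate h = h'.
  move=> p1 p2 hh'; rewrite /mate; case: pickP => [u /andP[/eqP pu hu] | /(_ h')] /=.
    exact: (class1_uniq h).
  by rewrite p2 hh'.
have mateP h : mate h != h -> adj h (mate h) /\ phi (mate h) = 1%N.
  rewrite /mate; case: pickP => [u /andP[/eqP pu hu] | _] /=; last by rewrite eqxx.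
  by [].
pose idx h := if (enum_rank (mate h) < enum_rank h)%N then (#|H| + enum_rank (mate h))%N
              else enum_rank h : nat.
pose g h := if phi h == 1%N then nth x0 p (idx h)
            else nth x0 (enum (F (phi h - 2)%N)) (enum_rank h).
have idx_lt h : (idx h < size p)%N by rewrite szp /idx; case: ifP => _; have := rk (mate h); have := rk h; lia.
have phib h : phi h != 1%N -> (phi h - 2 < k)%N by have := phi1 h; lia.
have gF h : phi h != 1%N -> g h \in F (phi h - 2)%N.
  move=> ph; rewrite /g (negbTE ph) -mem_enum mem_nth // -cardE.
  by have [_ ->] := F1 _ (phib _ ph).
have gp h : phi h = 1%N -> g h \in p by move=> ph; rewrite /g ph eqxx mem_nth.
have cross h h' : phi h = 1%N -> phi h' != 1%N -> adj (g h) (g h').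
  move=> ph ph'; have [/subsetP FB _] := F1 _ (phib _ ph').
  by move: (FB _ (gF _ ph')); rewrite inE => /forall_inP; apply; rewrite inE gp.
apply: (@contains_copyI G H phi g).
- move=> x y; have [px|px] := eqVneq (phi x) 1%N; have [py|py] := eqVneq (phi y) 1%N.
  + by rewrite px py.
  + by move=> _; exact: cross.
  + by move=> _; rewrite adj_sym; apply: cross.
  + move=> pxy; apply: (F2 _ _ _ _ (phib _ px) (phib _ py)) (gF _ px) (gF _ py).
    by have := phi1 x; have := phi1 y; move: pxy px py; lia.
- move=> x y; have [px|px] := eqVneq (phi x) 1%N => pxy /eqP; last first.
    have py : phi y != 1%N by rewrite -pxy.
    rewrite /g (negbTE px) (negbTE py) -pxy nth_uniq ?enum_uniq -?cardE //;
      try by have [_ ->] := F1 _ (phib _ px).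
    by move=> /eqP/val_inj/enum_rank_inj.
  have py : phi y = 1%N by rewrite -pxy.
  rewrite /g px py eqxx nth_uniq // /idx.
  have rx := rk x; have ry := rk y.
  case: ifP => hx; case: ifP => hy.
  + rewrite eqn_add2l => /eqP/val_inj/enum_rank_inj mxy.
    have [ax mx1] : adj x (mate x) /\ phi (mate x) = 1%N.
      by apply: mateP; apply: contraTneq hx => ->; rewrite ltnn.
    have [ay _] : adj y (mate y) /\ phi (mate y) = 1%N.
      by apply: mateP; apply: contraTneq hy => ->; rewrite ltnn.
    by apply: (class1_uniq (mate x)); rewrite // adj_sym // mxy.
  + by move=> /eqP; lia.
  + by move=> /eqP; lia.
  + by move=> /eqP/val_inj/enum_rank_inj.
- move=> x y pxy; have [px|px] := eqVneq (phi x) 1%N; last first.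
    move=> xy; have := phi1 x => /andP[p0 pk].
    have /phi3 : (2 <= phi x <= k.+1)%N by move: px p0 pk; lia.
    by move=> /(_ x y); rewrite !inE pxy eqxx xy => /(_ isT isT).
  have py : phi y = 1%N by rewrite -pxy.
  move=> xy.
  have yx : adj y x by rewrite adj_sym.
  have edge (u : H) : adj (nth x0 p (enum_rank u)) (nth x0 p (#|H| + enum_rank u)).
    have ur : (enum_rank u < size s)%N by rewrite szs.
    have := es _ (mem_nth (x0, x0) ur).
    rewrite /p !nth_cat !size_map ur szs ltnNge leq_addr /= addKn.
    by rewrite !(nth_map (x0, x0)).
  rewrite /g px py eqxx /idx (mateE _ _ px py xy) (mateE _ _ py px yx).
  case: (ltngtP (enum_rank x) (enum_rank y)) => [_|_|/val_inj/enum_rank_inj xyE].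
  + exact: edge.
  + by rewrite adj_sym; exact: edge.
  + by move: xy; rewrite xyE adj_irr.
Qed.

(** * Lower bounds: the extremal graphs *)

Section Construction.
Variables (n k : nat) (b : bool).

Let vertex_t : finType := ('I_n.+2 * 'I_n.+1 * 'I_k.+1)%type.

(** In a vertex (i, j, c), i is the part, c the colour and j singles out another
    part, namely [lift i j]; so with colour 0 the pair (i, i') of parts owns one
    vertex in each of the parts i and i', and these two are matched when b holds. *)
Definition extremal_adj : rel vertex_t := fun u v =>
  (u.1.1 != v.1.1) &&
  ((u.2 != v.2) || [&& b, u.2 == ord0, v.2 == ord0,
     lift u.1.1 u.1.2 == v.1.1 & lift v.1.1 v.1.2 == u.1.1]).

Fact extremal_adj_sym : symmetric extremal_adj.
Proof.
move=> u v; rewrite /extremal_adj eq_sym [u.2 == v.2]eq_sym.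
by congr (_ && (_ || (_ && _))); rewrite andbCA; congr [&& _, _ & _]; rewrite andbC.
Qed.

Fact extremal_adj_irr : irreflexive extremal_adj.
Proof. by move=> u; rewrite /extremal_adj eqxx. Qed.

Definition extremal_graph : sgraph := SGraph extremal_adj_sym extremal_adj_irr.

Definition extremal_part (i : 'I_n.+2) : {set extremal_graph} :=
  [set u | u.1.1 == i].

Lemma extremal_multipartite : multipartite extremal_part.
Proof.
split=> [i|i j ij||i u v].
- by apply/finset.set0Pn; exists (i, ord0, ord0); rewrite inE.
- rewrite -setI_eq0; apply/eqP/finset.setP => u; rewrite !inE.
  by apply/negbTE/negP => /andP[/eqP -> /eqP eij]; rewrite eij eqxx in ij.
- by apply/finset.setP => u; rewrite inE; apply/finset.bigcupP; exists u.1.1; rewrite ?inE.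
- by rewrite !inE => /eqP ui /eqP vi; rewrite /= /extremal_adj ui vi eqxx.
Qed.

Lemma card_extremal_part i : #|extremal_part i| = (n.+1 * k.+1)%N.
Proof.
have -> : extremal_part i =
    [set ((i, q.1, q.2) : vertex_t) | q in [set: 'I_n.+1 * 'I_k.+1]].
  apply/finset.setP => -[[i' j] c]; rewrite inE /=; apply/eqP/imsetP => [->|].
    by exists (j, c); rewrite ?inE.
  by move=> [q _ [-> _ _]].
rewrite card_imset; first by rewrite cardsT card_prod !card_ord.
by move=> [a c] [a' c'] [-> ->].
Qed.

Lemma extremal_edges i i' : i != i' ->
  (n.+1 * n.+1 * (k.+1 * k) + b <= edges_between (extremal_part i) (extremal_part i'))%N.
Proof.
move=> ii'; rewrite /edges_between.
set E := [set p in _ | _].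
pose f (q : ('I_n.+1 * 'I_n.+1) * ('I_k.+1 * 'I_k.+1)) : vertex_t * vertex_t :=
  ((i, q.1.1, q.2.1), (i', q.1.2, q.2.2)).
have f_inj : injective f by move=> [[? ?] [? ?]] [[? ?] [? ?]] [-> -> -> ->].
pose D := [set q : ('I_n.+1 * 'I_n.+1) * ('I_k.+1 * 'I_k.+1) | q.2.1 != q.2.2].
have cD : #|f @: D| = (n.+1 * n.+1 * (k.+1 * k))%N.
  rewrite card_imset //.
  have -> : D = finset.setX [set: 'I_n.+1 * 'I_n.+1] (~: [set (c, c) | c : 'I_k.+1]).
    apply/finset.setP => -[q [c c']]; rewrite !inE /=; congr (~~ _).
    by apply/eqP/imsetP => [->|[d _ [-> ->]]] //; exists c'.
  rewrite cardsX cardsT card_prod !card_ord cardsCs setCK card_prod !card_ord.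
  rewrite card_imset; first by rewrite card_ord -[X in (_ * _ - X)%N]muln1 -mulnBr subn1.
  by move=> c d [].
have DE : f @: D \subset E.
  apply/subsetP => _ /imsetP[q qD ->]; move: qD; rewrite !inE /= => qD.
  by rewrite /extremal_adj /= !eqxx ii' qD.
have [b1|b0] := boolP b; last by rewrite addn0 -cD; apply: subset_leq_card.
have [j ij _] := unlift_some ii'.
have i'i : i' != i by rewrite eq_sym.
have [j' ij' _] := unlift_some i'i.
pose p : vertex_t * vertex_t := ((i, j, ord0), (i', j', ord0)).
have pD : p \notin f @: D.
  by apply/imsetP => -[q]; rewrite inE => qD [_ e1 _ e2]; rewrite -e1 -e2 eqxx in qD.
have pDE : #|p |: f @: D| = (#|f @: D| + 1)%N by rewrite cardsU1 pD addnC.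
rewrite -cD -pDE; apply/subset_leq_card.
rewrite subUset DE andbT sub1set !inE /= /extremal_adj /= ii' !eqxx b1 /=.
by rewrite -ij -ij' !eqxx.
Qed.

Lemma extremal_density (R : realType) i i' : i != i' ->
  k%:R / k.+1%:R + b%:R / (k.+1%:R ^+ 2 * n.+1%:R ^+ 2) <=
  edge_density R (extremal_part i) (extremal_part i').
Proof.
move=> ii'; rewrite /edge_density !card_extremal_part natrM.
have p0 (a : nat) : a.+1%:R != 0 :> R by rewrite pnatr_eq0.
rewrite ler_pdivlMr; last by rewrite !mulr_gt0 ?ltr0n.
apply: le_trans (_ : (n.+1 * n.+1 * (k.+1 * k) + b)%:R <= _); last first.
  by rewrite ler_nat extremal_edges.
rewrite natrD !natrM; apply: le_of_eq; move: (p0 k) (p0 n).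
move: (k.+1%:R : R) (n.+1%:R : R) => K N K0 N0; field.
by rewrite K0 N0.
Qed.

Lemma extremal_colour (H : sgraph) (f : H -> extremal_graph) x y :
  adj (f x) (f y) -> (f x).2 != (f y).2 \/ b /\ (f x).2 = ord0 /\ (f y).2 = ord0 /\
    lift (f x).1.1 (f x).1.2 = (f y).1.1 /\ lift (f y).1.1 (f y).1.2 = (f x).1.1.
Proof.
move=> /andP[_ /orP[]]; first by left.
by move=> /and5P[-> /eqP -> /eqP -> /eqP -> /eqP ->]; right.
Qed.
End Construction.

Lemma chromatic_number_le (H : sgraph) k : colourable H k -> (chromatic_number H <= k)%N.
Proof. by rewrite /chromatic_number; case: ex_minnP => m _; apply. Qed.

Lemma extremal_free (H : sgraph) n k (b : bool) : chromatic_number H = k.+2 ->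
  (b -> ~ almost_colour_critical H) -> ~ contains_copy (extremal_graph n k b) H.
Proof.
move=> chi nacc [f [f_inj f_adj]]; case: b nacc f f_inj f_adj => [/(_ isT) nacc|_] f f_inj f_adj.
  apply: nacc; exists (fun x => (f x).2.+1); rewrite chi; split=> [x|| [//|[//|i]] _ x y].
  - by rewrite /= ltnS -ltnS.
  - apply/bigmax_leqP => x _; apply/card_le1_eqP => y z; rewrite !inE => xy xz.
    apply/val_inj/f_inj.
    have c0 (u : induced [set x | (f x).2.+1 == 1%N]) : (f (val u)).2 = ord0.
      by apply/val_inj; have := valP u; rewrite inE => /eqP[].
    have [|[_ [_ [_ [ly ly']]]]] := extremal_colour (f_adj _ _ xy).
      by rewrite !c0 eqxx.
    have [|[_ [_ [_ [lz lz']]]]] := extremal_colour (f_adj _ _ xz).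
      by rewrite !c0 eqxx.
    move: (c0 y) (c0 z) ly ly' lz lz'.
    case: (f (val y)) => [[a1 a2] a3]; case: (f (val z)) => [[b1 b2] b3] /=.
    move=> -> -> <- e1 <- e2; congr (_, _, _).
    by apply: (@lift_inj _ (lift (f (val x)).1.1 (f (val x)).1.2)); rewrite e1 e2.
  - rewrite !inE => /eqP[fx] /eqP[fy]; apply/negP => /f_adj /extremal_colour[].
      by apply/negP; rewrite negbK; apply/eqP/val_inj; rewrite /= fx fy.
    by move=> [_ [e _]]; rewrite e in fx.
have /chromatic_number_le : colourable H k.+1; last by rewrite chi ltnn.
apply/existsP; exists [ffun x => (f x).2]; apply/forallP => x; apply/forallP => y.
by apply/implyP => /f_adj /extremal_colour[|[]] //; rewrite !ffunE.
Qed.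

Lemma partite_density_ge (R : realType) (H : sgraph) n k (b : bool) :
  has_edge H -> chromatic_number H = k.+2 -> (b -> ~ almost_colour_critical H) ->
  k%:R / k.+1%:R + b%:R / (k.+1%:R ^+ 2 * n.+1%:R ^+ 2) <= partite_density R n.+2 H.
Proof.
move=> eH chi nacc; have [dF _] := partite_densityP R (isT : (1 < n.+2)%N) eH.
rewrite leNgt; apply/negP => lt; apply: (extremal_free (n := n) chi nacc).
apply: dF (extremal_multipartite n k b) _ => i j ij.
exact: lt_le_trans lt (extremal_density _ _ _ ij).
Qed.

Lemma chromatic_number_ge2 (H : sgraph) : has_edge H -> exists k, chromatic_number H = k.+2.
Proof.
move=> [x [y xy]]; rewrite /chromatic_number.
case: ex_minnP => -[|[|m]] /existsP[c /forallP/(_ x)/forallP/(_ y)/implyP/(_ xy)] cP _.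
- by case: (c x).
- by move: cP; rewrite !ord1 eqxx.
- by exists m.
Qed.

(** * Bilinear edge counts and dense families of parts *)

Section Bilinear.
Variables (R : realType) (G : sgraph).
Implicit Types (P : rel G) (f g : G -> R) (col : G -> nat).

Definition bil P f g : R := \sum_x \sum_y f x * g y * (P x y)%:R.

Lemma bil_ge0 P f g : (forall x, 0 <= f x) -> (forall x, 0 <= g x) -> 0 <= bil P f g.
Proof. by move=> f0 g0; apply: sumr_ge0 => x _; apply: sumr_ge0 => y _; rewrite !mulr_ge0. Qed.

Lemma bilE P f g : bil P f g = \sum_x f x * \sum_y g y * (P x y)%:R.
Proof.
by apply: eq_bigr => x _; rewrite mulr_sumr; apply: eq_bigr => y _; rewrite mulrA.
Qed.

Lemma bil_sum (I : finType) (B : {set I}) P (f : I -> G -> R) :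
  bil P (fun x => \sum_(i in B) f i x) (fun x => \sum_(i in B) f i x) =
  \sum_(i in B) \sum_(j in B) bil P (f i) (f j).
Proof.
transitivity (\sum_(i in B) bil P (f i) (fun x => \sum_(j in B) f j x)).
  rewrite /bil [RHS]exchange_big; apply: eq_bigr => x _ /=.
  rewrite [RHS]exchange_big; apply: eq_bigr => y _ /=.
  by rewrite -mulr_suml -mulr_suml.
apply: eq_bigr => i _; rewrite /bil.
rewrite [RHS]exchange_big; apply: eq_bigr => x _ /=.
rewrite [RHS]exchange_big; apply: eq_bigr => y _ /=.
by rewrite -mulr_suml -mulr_sumr.
Qed.

Lemma bil_scale P f (a : R) :
  bil P (fun x => f x * a) (fun x => f x * a) = bil P f f * a ^+ 2.
Proof.
rewrite /bil mulr_suml; apply: eq_bigr => x _; rewrite mulr_suml.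
by apply: eq_bigr => y _; ring.
Qed.

Lemma eq_bil P P' f g f' g' : P =2 P' -> f =1 f' -> g =1 g' -> bil P f g = bil P' f' g'.
Proof.
move=> eP ef eg; apply: eq_bigr => x _; apply: eq_bigr => y _.
by rewrite eP ef eg.
Qed.

Definition inner col : rel G := fun x y => adj x y && (col x == col y).
Definition missing col : rel G := fun x y => (col x != col y) && ~~ adj x y.
Definition class_mass col f c : R := \sum_(x | col x == c) f x.

(** Adjacency equals 1 minus same-coloured, minus missing, plus inner, pointwise.
    Since f and g have total weight 1, the same-coloured weight is
    1 / (k + 1) plus the inner product of the centred vectors of class weights. *)
Lemma bil_adjE (k : nat) col f g : (forall x, (col x < k.+1)%N) ->
  \sum_x f x = 1 -> \sum_x g x = 1 ->
  bil (@adj G) f g = 1 - k.+1%:R^-1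
    - \sum_(c < k.+1) (class_mass col f c - k.+1%:R^-1) * (class_mass col g c - k.+1%:R^-1)
    - bil (missing col) f g + bil (inner col) f g.
Proof.
move=> colr f1 g1.
have cm h : \sum_(c < k.+1) class_mass col h c = \sum_x h x.
  rewrite /class_mass; under eq_bigr do rewrite big_mkcond; rewrite exchange_big /=.
  apply: eq_bigr => x _; rewrite (bigD1 (Ordinal (colr x))) //= eqxx big1 ?addr0 //.
  by move=> c; rewrite -val_eqE /= eq_sym => /negbTE ->.
have same : bil (fun x y => col x == col y) f g =
    \sum_(c < k.+1) class_mass col f c * class_mass col g c.
  have -> : \sum_(c < k.+1) class_mass col f c * class_mass col g c =
     \sum_(c < k.+1) \sum_x (if col x == c then f x * class_mass col g c else 0).
    by apply: eq_bigr => c _; rewrite -big_mkcond mulr_suml.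
  rewrite exchange_big; apply: eq_bigr => x _ /=.
  rewrite (bigD1 (Ordinal (colr x))) //= eqxx [X in _ + X]big1 ?addr0; last first.
    by move=> c; rewrite -val_eqE /= eq_sym => /negbTE ->.
  rewrite /class_mass mulr_sumr [RHS]big_mkcond; apply: eq_bigr => y _.
  by rewrite eq_sym; case: eqP; rewrite ?mulr1 ?mulr0.
have all : bil (fun _ _ => true) f g = 1.
  rewrite -f1; apply: eq_bigr => x _; rewrite -[RHS]mulr1 -g1 mulr_sumr.
  by apply: eq_bigr => y _; rewrite g1 mulr1.
have -> : bil (@adj G) f g = bil (fun _ _ => true) f g - bil (fun x y => col x == col y) f g
    - bil (missing col) f g + bil (inner col) f g.
  rewrite /bil -!sumrB -big_split; apply: eq_bigr => x _.
  rewrite -!sumrB -big_split; apply: eq_bigr => y _ /=.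
  rewrite /missing /inner; case: (adj x y); case: (col x == col y) => /=; ring.
rewrite all same.
have -> : \sum_(c < k.+1) (class_mass col f c - k.+1%:R^-1) * (class_mass col g c - k.+1%:R^-1)
  = \sum_(c < k.+1) class_mass col f c * class_mass col g c - k.+1%:R^-1.
  under eq_bigr => c _ do rewrite mulrBl !mulrBr.
  rewrite sumrB !sumrB -mulr_suml -mulr_sumr !cm f1 g1 sumr_const card_ord.
  have r0 : k.+1%:R != 0 :> R by rewrite pnatr_eq0.
  have -> : k.+1%:R^-1 / k.+1%:R *+ k.+1 = k.+1%:R^-1 :> R.
    by rewrite -mulrnAr -(mulr_natl k.+1%:R^-1) divff // mulr1.
  by rewrite mulr1 mul1r subrr subr0.
by ring.
Qed.
End Bilinear.

Section Parts.
Variables (R : realType) (G : sgraph) (I : finType) (k : nat).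
Variables (part : G -> I) (nu : G -> R).
Implicit Types (B : {set I}) (i j : I) (x y : G).

(** The form in which the hypothesis on the densities is used: nu stands for the
    uniform weight 1 / |V_i| on each part V_i. *)
Definition dense_parts : Prop :=
  [/\ forall x, 0 <= nu x <= 1,
      forall i, \sum_(x | part x == i) nu x = 1,
      forall x y, adj x y -> part x != part y &
      forall i j, i != j -> 1 - k.+1%:R^-1 <
        \sum_(x | part x == i) \sum_(y | part y == j) nu x * nu y * (adj x y)%:R].

Definition on_part (i : I) x : R := if part x == i then nu x else 0.
Definition on_parts (B : {set I}) x : R := if part x \in B then nu x else 0.
Definition mean_weight (B : {set I}) x : R := on_parts B x / #|B|%:R.

Hypothesis dense : dense_parts.

Lemma nu_ge0 x : 0 <= nu x. Proof. by case: dense => /(_ x)/andP[]. Qed.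

Lemma on_part_ge0 i x : 0 <= on_part i x.
Proof. by rewrite /on_part; case: ifP => // _; apply: nu_ge0. Qed.

Lemma on_parts_ge0 B x : 0 <= on_parts B x.
Proof. by rewrite /on_parts; case: ifP => // _; apply: nu_ge0. Qed.

Lemma mean_weight_ge0 B x : 0 <= mean_weight B x.
Proof. by rewrite mulr_ge0 ?on_parts_ge0 // invr_ge0. Qed.

Lemma sum_on_part i : \sum_x on_part i x = 1.
Proof. by rewrite /on_part -big_mkcond; case: dense => _ ->. Qed.

Lemma on_partsE B x : on_parts B x = \sum_(i in B) on_part i x.
Proof.
rewrite /on_parts /on_part; case: ifP => xB; last first.
  by rewrite big1 // => i iB; case: eqP => // xi; rewrite xi iB in xB.
rewrite (bigD1 (part x)) //= eqxx big1 ?addr0 // => i /andP[_].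
by rewrite eq_sym => /negbTE ->.
Qed.

Lemma sum_on_parts B : \sum_x on_parts B x = #|B|%:R.
Proof.
under eq_bigr do rewrite on_partsE.
by rewrite exchange_big /= (eq_bigr (fun=> 1)) ?sumr_const // => i _; apply: sum_on_part.
Qed.

Lemma mean_weighting B : weighting (mean_weight B).
Proof.
split=> [x|]; first exact: mean_weight_ge0.
rewrite -mulr_suml sum_on_parts; have [->|n0] := eqVneq (#|B|%:R : R) 0.
  by rewrite mul0r ler01.
by rewrite divff.
Qed.

Lemma sum_mean_weight B : (0 < #|B|)%N -> \sum_x mean_weight B x = 1.
Proof. by move=> B0; rewrite -mulr_suml sum_on_parts divff // pnatr_eq0 -lt0n. Qed.

Lemma mean_weight_le B x : mean_weight B x <= #|B|%:R^-1.
Proof.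
rewrite -[leRHS]mul1r ler_wpM2r ?invr_ge0 // /on_parts; case: ifP => // _.
by case: dense => /(_ x)/andP[].
Qed.

Lemma bil_on_part (P : rel G) i j : bil P (on_part i) (on_part j) =
  \sum_(x | part x == i) \sum_(y | part y == j) nu x * nu y * (P x y)%:R.
Proof.
rewrite /bil [RHS]big_mkcond; apply: eq_bigr => x _; rewrite /on_part.
case: ifP => _; last by rewrite big1 // => y _; rewrite !mul0r.
rewrite [RHS]big_mkcond; apply: eq_bigr => y _; case: ifP => //.
by rewrite mulr0 mul0r.
Qed.

Lemma bil_adj_gt i j : i != j -> 1 - k.+1%:R^-1 < bil (@adj G) (on_part i) (on_part j).
Proof. by move=> ij; rewrite bil_on_part; case: dense => _ _ _; apply. Qed.

Lemma turan_bound_ge0 : 0 <= 1 - k.+1%:R^-1 :> R.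
Proof. by rewrite subr_ge0 invf_le1 ?ler1n ?ltr0n. Qed.

(** Averaging over ordered pairs of parts, of which only the fraction 1/#|B| on
    the diagonal is not dense. *)
Lemma bil_adj_mean B : (0 < #|B|)%N ->
  1 - k.+1%:R^-1 - #|B|%:R^-1 <= bil (@adj G) (mean_weight B) (mean_weight B).
Proof.
move=> B0; have L0 : 0 < #|B|%:R :> R by rewrite ltr0n.
rewrite /mean_weight bil_scale.
rewrite (eq_bil (fun _ _ => erefl) (on_partsE B) (on_partsE B)) bil_sum.
have t0 := turan_bound_ge0; set t := 1 - _ in t0 *.
have tl1 : t <= 1 by rewrite gerBl invr_ge0.
have : \sum_(i in B) \sum_(j in B) (if i == j then 0 else t) <=
       \sum_(i in B) \sum_(j in B) bil (@adj G) (on_part i) (on_part j).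
  apply: ler_sum => i _; apply: ler_sum => j _.
  have [_|/bil_adj_gt/ltW //] := eqVneq i j.
  by apply: bil_ge0; apply: on_part_ge0.
set S := \sum_(i in B) \sum_(j in B) bil _ _ _ => le.
have : #|B|%:R * (#|B|%:R * t - 1) <= S.
  apply: le_trans le; rewrite mulr_natl -sumr_const; apply: ler_sum => i iB.
  rewrite (bigD1 i) //= eqxx add0r.
  have -> : \sum_(j in B | j != i) (if i == j then 0 else t) =
    \sum_(j in B | j != i) t.
    by apply: eq_bigr => j /andP[_]; rewrite eq_sym => /negbTE ->.
  have : \sum_(j in B) t = t + \sum_(j in B | j != i) t by rewrite (bigD1 i).
  by rewrite sumr_const -mulr_natl => e; lra.
move=> h; rewrite exprVn ler_pdivlMr ?exprn_gt0 //; apply: le_trans h.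
by apply: le_of_eq; field; rewrite gt_eqF.
Qed.

(** In [bil_adjE] with equal weights the inner product is a sum of squares, so few
    inner edges and density 1 - 1 / (k + 1) bound both the missing weight and the
    deviation of each class weight from 1 / (k + 1). *)
Lemma near_turan B (col : G -> nat) (e e' : R) : (forall x, (col x < k.+1)%N) ->
  (0 < #|B|)%N ->
  bil (inner col) (mean_weight B) (mean_weight B) <= e -> e + #|B|%:R^-1 <= e' ->
  bil (missing col) (mean_weight B) (mean_weight B) <= e' /\
  (e' <= (2 * k.+1%:R)^-1 ^+ 2 -> forall c, (c < k.+1)%N ->
     (2 * k.+1%:R)^-1 <= class_mass col (mean_weight B) c).
Proof.
move=> colr B0 ins le_e'.
have adjB := bil_adj_mean B0.
have := bil_adjE colr (sum_mean_weight B0) (sum_mean_weight B0).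
set S := \sum_(c < _) _ => adjE.
have mis0 : 0 <= bil (missing col) (mean_weight B) (mean_weight B).
  by apply: bil_ge0; apply: mean_weight_ge0.
have S0 : 0 <= S by apply: sumr_ge0 => c _; rewrite -expr2 sqr_ge0.
have misS : S + bil (missing col) (mean_weight B) (mean_weight B) <= e'.
  move: adjB adjE; set q := k.+1%:R^-1; set v := bil (@adj G) _ _; lra.
split=> [|e'k c cr]; first by lra.
have : (class_mass col (mean_weight B) c - k.+1%:R^-1) ^+ 2 <= S.
  rewrite /S (bigD1 (Ordinal cr)) //= -expr2 lerDl.
  by apply: sumr_ge0 => d _; rewrite -expr2 sqr_ge0.
set p := class_mass _ _ _ => pS.
have : (p - k.+1%:R^-1) ^+ 2 <= (2 * k.+1%:R)^-1 ^+ 2.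
  by apply: le_trans pS _; apply: le_trans e'k; lra.
have q0 : 0 <= (2 * k.+1%:R)^-1 :> R by rewrite invr_ge0 mulr_ge0.
rewrite -ler_sqrt ?exprn_ge0 // !sqrtr_sqr [X in _ <= X]ger0_norm //.
rewrite ler_norml => /andP[h _].
have e2 : k.+1%:R^-1 = 2 * (2 * k.+1%:R)^-1 :> R.
  by rewrite invfM mulrA divff ?mul1r // pnatr_eq0.
by move: h; rewrite e2; set a := (2 * _)^-1; lra.
Qed.
End Parts.

(** * The structured case *)

(** Outside the common neighbourhood of S, each vertex of class c is missed by a
    vertex of S. *)
Lemma mass_common_nbr (R : realType) (G : sgraph) (mu : G -> R) (col : G -> nat)
    (S : {set G}) c d : (forall x, 0 <= mu x) ->
  (forall x, x \in S -> col x = d) -> c != d ->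
  class_mass col mu c <= \sum_(y in common_nbr S | col y == c) mu y +
     \sum_(x in S) \sum_y mu y * (missing col x y)%:R.
Proof.
move=> mu0 Sd cd; rewrite exchange_big /= /class_mass.
rewrite big_mkcond [X in X + _]big_mkcond -big_split /=.
apply: ler_sum => y _.
have s0 : 0 <= \sum_(x in S) mu y * (missing col x y)%:R.
  by apply: sumr_ge0 => x _; rewrite mulr_ge0.
have [cy|] := boolP (col y == c); last by rewrite andbF add0r.
rewrite andbT; case: ifP => [_|/negbT]; first by rewrite lerDl.
rewrite inE negb_forall => /existsP[x]; rewrite negb_imply => /andP[xS nadj].
rewrite add0r (bigD1 x) //= /missing (eqP cy) Sd // eq_sym cd nadj mulr1 lerDl.
by apply: sumr_ge0 => z _; rewrite mulr_ge0.
Qed.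

(** The 2 #|H| ends of the matching together miss weight at most Q, so their common
    neighbourhood keeps weight Q in each other class; this gives cliques there, and
    then a complete k-partite graph. *)
Lemma typical_matching_copy (R : realType) (H : sgraph) k (Q : R) :
  has_edge H -> almost_colour_critical H -> chromatic_number H = k.+2 -> 0 < Q ->
  exists gam alpha : R, [/\ 0 < gam, 0 < alpha &
  forall (G : sgraph) (mu : G -> R) (col : G -> nat) (c : nat) (s : seq (G * G)),
    weighting mu -> (forall x, mu x <= alpha) ->
    (c < k.+1)%N -> (forall d, (d < k.+1)%N -> Q * 2 <= class_mass col mu d) ->
    bil (missing col) mu mu <= gam ->
    size s = #|H| -> uniq (unzip1 s ++ unzip2 s) ->
    (forall p, p \in s -> adj p.1 p.2) ->
    (forall x, x \in unzip1 s ++ unzip2 s -> col x = c /\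
       \sum_y mu y * (missing col x y)%:R <= Q / (2 * #|H|%:R)) ->
    contains_copy G H].
Proof.
move=> eH acc chi Q0.
have [gam [eta [gam0 eta0 classesP]]] := clique_mass_classes k Q0.
have [alpha [alpha0 blowP]] := clique_mass_blowup k #|H| eta0.
exists gam, alpha; split=> // G mu col c s wmu mualpha ck classes mis szs us es sP.
have [mu0 mu1] := wmu; have H0 : (0 < #|H|)%N by have [h _] := eH; apply/card_gt0P; exists h.
apply: (contains_copy_matching eH acc chi szs us es).
set S := [set x in _].
apply: (blowP G mu _ wmu mualpha).
pose t := [seq d <- iota 0 k.+1 | d != c].
apply: (classesP G mu col _ t wmu).
- have := count_predC (pred1 c) (iota 0 k.+1); rewrite size_iota (count_uniq_mem _ (iota_uniq _ _)).
  by rewrite mem_iota add0n ck -size_filter -/t => -[].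
- by rewrite filter_uniq ?iota_uniq.
- move=> d; rewrite mem_filter mem_iota add0n => /andP[dc /andP[_ dk]].
  have Sc x : x \in S -> col x = c by rewrite inE => /sP[].
  have := mass_common_nbr mu0 Sc dc; have := classes d dk.
  have : \sum_(x in S) \sum_y mu y * (missing col x y)%:R <= Q.
    apply: le_trans (_ : \sum_(x in S) Q / (2 * #|H|%:R) <= _).
      by apply: ler_sum => x; rewrite inE => /sP[].
    rewrite sumr_const cardsE (card_uniqP us) size_cat !size_map szs.
    rewrite -[leLHS]mulr_natr natrD; apply: le_of_eq; field.
    by rewrite pnatr_eq0 -lt0n.
  lra.
- apply: le_trans mis; rewrite /bil big_mkcond; apply: ler_sum => x _.
  have m0 y : 0 <= mu x * mu y * ((col x != col y) && ~~ adj x y)%:R.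
    by rewrite !mulr_ge0.
  case: ifP => _; last exact: sumr_ge0.
  by rewrite big_mkcond; apply: ler_sum => y _; case: ifP.
Qed.

(** The exact count that rules out the remaining parts: each pair of them has more
    inner than missing weight, whereas inner edges all have a bad end, and a bad
    vertex sees at least twice as much missing as inner weight.  The factor 2 pays
    for counting an inner edge at both of its ends. *)
Lemma inner_le_missing_absurd (R : realType) (G : sgraph) (I : finType) k
    (part : G -> I) (nu : G -> R) (B : {set I}) (col : G -> nat) (bad : pred G)
    (e : R) :
  dense_parts k part nu -> (1 < #|B|)%N -> (forall x, (col x < k.+1)%N) ->
  (forall i j, i \in B -> j \in B -> 0 <=
     \sum_(c < k.+1) (class_mass col (on_part part nu i) c - k.+1%:R^-1) *
                     (class_mass col (on_part part nu j) c - k.+1%:R^-1)) ->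
  (forall x y, part x \in B -> part y \in B -> inner col x y -> bad x || bad y) ->
  (forall x, part x \in B -> bad x ->
     \sum_y on_parts part nu B y * (inner col x y)%:R <= e) ->
  (forall x, part x \in B -> bad x ->
     2 * e <= \sum_y on_parts part nu B y * (missing col x y && (part x != part y))%:R) ->
  False.
Proof.
move=> dense B2 colk signs badP inner_e missing_e.
pose u := on_parts part nu B.
have u0 x : 0 <= u x by apply: on_parts_ge0 dense _ _.
pose mis' : rel G := fun x y => missing col x y && (part x != part y).
have uE P : bil P u u = \sum_(i in B) \sum_(j in B) bil P (on_part part nu i) (on_part part nu j).
  by rewrite (eq_bil (fun _ _ => erefl) (on_partsE _ _ B) (on_partsE _ _ B)) bil_sum.
have diag (P : rel G) i : (forall x y, P x y -> part x != part y) ->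
    bil P (on_part part nu i) (on_part part nu i) = 0.
  move=> Pp; rewrite bil_on_part; apply: big1 => x /eqP xi; apply: big1 => y /eqP yi.
  have /negbTE -> : ~~ P x y by apply: contraT => /negbNE/Pp; rewrite xi yi eqxx.
  by rewrite mulr0.
(* Diagonal terms vanish, as neither relation holds within a part. *)
have lt_bil : bil mis' u u < bil (inner col) u u.
  rewrite !uE.
  have strict i j : i \in B -> j \in B -> i != j ->
     bil mis' (on_part part nu i) (on_part part nu j) <
     bil (inner col) (on_part part nu i) (on_part part nu j).
    move=> iB jB ij; have := bil_adj_gt dense ij.
    rewrite (bil_adjE colk (sum_on_part dense i) (sum_on_part dense j)).
    have := signs i j iB jB; set S := \sum_(c < _) _.
    have -> : bil mis' (on_part part nu i) (on_part part nu j) =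
       bil (missing col) (on_part part nu i) (on_part part nu j).
      rewrite !bil_on_part; apply: eq_bigr => x /eqP xi; apply: eq_bigr => y /eqP yj.
      by rewrite /mis' xi yj ij andbT.
    set q := _^-1; set a := bil _ _ _; set b := bil _ _ _; lra.
  have weak i j : i \in B -> j \in B ->
     bil mis' (on_part part nu i) (on_part part nu j) <=
     bil (inner col) (on_part part nu i) (on_part part nu j).
    move=> iB jB; have [->|ij] := eqVneq i j; last by rewrite ltW ?strict.
    rewrite !diag //; last by move=> x y /andP[].
    by move=> x y /andP[xy _]; case: dense => _ _ h _; apply: h.
  have /card_gt1P[i [j [iB jB ij]]] := B2.
  rewrite (bigD1 i) // [ltRHS](bigD1 i) //=; apply: ltr_leD; last first.
    by apply: ler_sum => i' /andP[i'B _]; apply: ler_sum => j' j'B; apply: weak.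
  rewrite (bigD1 j) // [ltRHS](bigD1 j) //=; apply: ltr_leD; first exact: strict.
  by apply: ler_sum => j' /andP[j'B _]; apply: weak.
have inner_le : bil (inner col) u u <=
    2 * \sum_x (if bad x then u x else 0) * \sum_y u y * (inner col x y)%:R.
  have -> : 2 * (\sum_x (if bad x then u x else 0) * \sum_y u y * (inner col x y)%:R) =
     \sum_x \sum_y u x * u y * ((bad x)%:R * (inner col x y)%:R) +
     \sum_x \sum_y u x * u y * ((bad y)%:R * (inner col x y)%:R).
    rewrite [X in _ + X]exchange_big /= mulr_natl mulr2n; congr (_ + _).
      apply: eq_bigr => x _; rewrite mulr_sumr; apply: eq_bigr => y _.
      by case: (bad x); rewrite /= ?mul0r ?mulr0 // mul1r mulrA.
    apply: eq_bigr => x _; rewrite mulr_sumr; apply: eq_bigr => y _.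
    rewrite /inner adj_sym [col y == _]eq_sym.
    by case: (bad x); rewrite /= ?mul0r ?mulr0 // mul1r mulrA [u y * _]mulrC.
  rewrite -big_split; apply: ler_sum => x _; rewrite -big_split; apply: ler_sum => y _ /=.
  rewrite -mulrDr -mulrDl; case: (boolP (part x \in B)) => xB; last first.
    by rewrite /u /on_parts (negbTE xB) !mul0r.
  case: (boolP (part y \in B)) => yB; last first.
    by rewrite /u /on_parts (negbTE yB) !mulr0 !mul0r.
  rewrite ler_wpM2l ?mulr_ge0 //.
  have [/(badP _ _ xB yB)|_] := boolP (inner col x y); last by rewrite mulr0.
  by rewrite mulr1; case: (bad x); case: (bad y) => //= _; lra.
have le_mis : \sum_x (if bad x then u x else 0) * \sum_y u y * (mis' x y)%:R <= bil mis' u u.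
  rewrite bilE; apply: ler_sum => x _; case: ifP => // _.
  by rewrite mul0r mulr_ge0 // sumr_ge0 // => y _; rewrite mulr_ge0.
have : 2 * \sum_x (if bad x then u x else 0) * \sum_y u y * (inner col x y)%:R <=
       \sum_x (if bad x then u x else 0) * \sum_y u y * (mis' x y)%:R.
  rewrite mulr_sumr; apply: ler_sum => x _; case: ifP => bx; last by rewrite !mul0r mulr0.
  case: (boolP (part x \in B)) => xB; last by rewrite /u /on_parts (negbTE xB) !mul0r mulr0.
  rewrite mulrCA ler_wpM2l //; apply: le_trans (missing_e x xB bx).
  by rewrite ler_pM2l // inner_e.
lra.
Qed.

Lemma leq_card_bigcup (T J : finType) (W : J -> {set T}) (w : nat) :
  (forall j, (#|W j| <= w)%N) -> (#|\bigcup_j W j| <= #|J| * w)%N.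
Proof.
move=> Ww; rewrite -sum_nat_const.
elim/big_rec2: _ => [|j a A _ le]; first by rewrite cards0.
by apply: leq_trans (leq_card_setU _ _) _; rewrite leq_add.
Qed.

(** By [near_turan] the classes have weight at least half of 1 / (k + 1).  Call this
    2Q: one Q may be lost to the exceptions of a bounded number of vertices. *)
Lemma half_fair_share (R : realType) k :
  exists Q : R, [/\ 0 < Q, Q <= 1 & (2 * k.+1%:R)^-1 = Q * 2].
Proof.
have : 1 <= k.+1%:R :> R by rewrite ler1n.
move: (k.+1%:R : R) => q q1; exists (4 * q)^-1; split.
- by rewrite invr_gt0; lra.
- by rewrite invf_le1; lra.
- by field; rewrite gt_eqF // (lt_le_trans ltr01).
Qed.

(** Parts with a colouring in which every vertex has few inner neighbours, and with
    pairwise non-negative inner products of the centred class weights, contain H: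
    otherwise [typical_matching_copy] provides in each class a bounded cover of the
    inner edges between typical vertices, and [inner_le_missing_absurd] applies once
    the parts of the covers are removed. *)
Lemma structured_parts_copy (R : realType) (H : sgraph) k :
  has_edge H -> almost_colour_critical H -> chromatic_number H = k.+2 ->
  exists (e : R) (L : nat), 0 < e /\
  forall (G : sgraph) (I : finType) (part : G -> I) (nu : G -> R) (B : {set I})
    (col : G -> nat),
    dense_parts k part nu -> (L <= #|B|)%N -> (forall x, (col x < k.+1)%N) ->
    (forall x, part x \in B -> \sum_y mean_weight part nu B y * (inner col x y)%:R <= e) ->
    (forall i j, i \in B -> j \in B -> 0 <=
      \sum_(c < k.+1) (class_mass col (on_part part nu i) c - k.+1%:R^-1) *
                      (class_mass col (on_part part nu j) c - k.+1%:R^-1)) ->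
    contains_copy G H.
Proof.
move=> eH acc chi; set m := #|H|.
have m0 : (0 < m)%N by have [h _] := eH; apply/card_gt0P; exists h.
have mR : 1 <= m%:R :> R by rewrite ler1n.
have [Q [Q0 Q1 QE]] := half_fair_share R k.
have [gam [alpha [gam0 alpha0 copyP]]] := typical_matching_copy eH acc chi Q0.
pose delta := Q / (2 * m%:R).
have delta0 : 0 < delta by rewrite divr_gt0 // mulr_gt0 // ltr0n.
have delta1 : delta <= 1.
  rewrite ler_pdivrMr ?mulr_gt0 ?ltr0n // mul1r; lra.
have [e [e0 e_delta e_gam e_Q]] : exists e : R,
    [/\ 0 < e, e <= delta / 4, e <= gam / 2 & e <= Q ^+ 2].
  exists (Num.min (delta / 4) (Num.min (gam / 2) (Q ^+ 2))).
  rewrite !ge_min !lexx !orbT; split=> //.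
  by rewrite !lt_min exprn_gt0 // andbT; apply/andP; split; lra.
have [beta [beta0 b_e b_alpha b_delta]] : exists beta : R,
    [/\ 0 < beta, beta <= e, beta <= alpha & beta <= delta / 2].
  exists (Num.min e (Num.min alpha (delta / 2))).
  by rewrite !ge_min !lexx !orbT !lt_min e0 alpha0 divr_gt0.
(* The covers remove at most k.+1 * (2 * m) parts; one more part is lost because a
   vertex has no neighbours in its own part. *)
have [K KE] : exists K, K = (1 + k.+1 * (2 * m))%N by exists (1 + k.+1 * (2 * m))%N.
have [L0 [_ ltL0]] := exists_nat_mul_gt K%:R beta0.
exists e, L0; split=> // G I part nu B col dense leL0 colk inner_e signs.
apply: contrapT => nocopy.
have ltK : K%:R < #|B|%:R * beta.
  by apply: lt_le_trans ltL0 _; rewrite ler_wpM2r ?ler_nat // ltW.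
have ltKB : (K < #|B|)%N.
  rewrite -(ltr_nat R); apply: lt_le_trans ltK _.
  by rewrite -[leRHS]mulr1 ler_wpM2l //; lra.
have B0 : (0 < #|B|)%N by apply: leq_ltn_trans ltKB.
have BR : 0 < #|B|%:R :> R by rewrite ltr0n.
have vbeta : #|B|%:R^-1 <= beta.
  rewrite -[leLHS]mul1r ler_pdivrMr // mulrC; apply: le_trans (ltW ltK).
  by rewrite ler1n KE.
set mu := mean_weight part nu B in inner_e.
have wmu : weighting mu by apply: mean_weighting dense _.
have [mu0 mu1] := wmu.
have mu_out x : part x \notin B -> mu x = 0.
  by move=> xB; rewrite /mu /mean_weight /on_parts (negbTE xB) mul0r.
have ins : bil (inner col) mu mu <= e.
  rewrite bilE -[leRHS]mul1r -[X in X * e](sum_mean_weight dense B0) mulr_suml.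
  apply: ler_sum => x _; have [xB|xB] := boolP (part x \in B).
    by rewrite ler_wpM2l // inner_e.
  by rewrite -/mu mu_out // !mul0r.
have e2 : e + #|B|%:R^-1 <= 2 * e by lra.
have [mis classes] := near_turan dense colk B0 ins e2.
have {}classes d : (d < k.+1)%N -> Q * 2 <= class_mass col mu d.
  by rewrite QE in classes; apply: classes; rewrite exprMn; lra.
pose typical x := (part x \in B) && (\sum_y mu y * (missing col x y)%:R <= delta).
pose inner_typical (c : nat) : rel G := fun x y => [&& adj x y, col x == c, col y == c, typical x & typical y].
have cover (c : 'I_k.+1) : exists W : {set G}, (#|W| <= 2 * m)%N /\
    forall x y, inner_typical c x y -> (x \in W) || (y \in W).
  have irr : irreflexive (inner_typical c) by move=> x; rewrite /inner_typical adj_irr.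
  have [[s [szs us es]]|//] := matching_or_cover m irr.
  case: nocopy; apply: (copyP G mu col c s wmu) => //.
  - by move=> x; apply: le_trans (mean_weight_le dense _ _) _; lra.
  - by lra.
  - by move=> p /es /andP[].
  - move=> x; rewrite mem_cat => /orP[] /mapP[p /es /and5P[_ /eqP c1 /eqP c2 g1 g2] ->].
      by case/andP: g1.
    by case/andP: g2.
have [W WP] := fin_all_exists cover.
pose D := [set part x | x in \bigcup_c W c].
have cD : (#|D| <= k.+1 * (2 * m))%N.
  apply: leq_trans (leq_imset_card _ _) _; rewrite -[X in (X * _)%N]card_ord.
  by apply: leq_card_bigcup => c; have [] := WP c.
have DR : #|D|%:R + 1 <= K%:R :> R.
  by rewrite -(natrD _ _ 1) ler_nat KE addnC leq_add2l.
have WD c x : x \in W c -> part x \in D.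
  by move=> xW; apply/imsetP; exists x => //; apply/finset.bigcupP; exists c.
have muE x : #|B|%:R * mu x = on_parts part nu B x.
  by rewrite /mu /mean_weight mulrC divfK // gt_eqF.
apply: (@inner_le_missing_absurd R G I k part nu (B :\: D) col (fun x => ~~ typical x)
  (#|B|%:R * e)) => //.
- rewrite cardsD; have := subset_leq_card (subsetIr B D); move: ltKB cD; rewrite KE; clear; lia.
- by move=> i j; rewrite !inE => /andP[_ iB] /andP[_ jB]; apply: signs.
- move=> x y; rewrite !inE => /andP[xD xB] /andP[yD yB] /andP[xy cxy].
  rewrite -negb_and; apply/negP => /andP[gx gy].
  have [_ /(_ x y)] := WP (Ordinal (colk x)).
  rewrite /inner_typical /= xy eqxx eq_sym cxy gx gy => /(_ isT) /orP[] /WD h.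
    by rewrite h in xD.
  by rewrite h in yD.
- move=> x; rewrite inE => /andP[_ xB] _.
  apply: le_trans (_ : #|B|%:R * \sum_y mu y * (inner col x y)%:R <= _); last first.
    by rewrite ler_pM2l // inner_e.
  rewrite mulr_sumr; apply: ler_sum => y _; rewrite mulrA muE ler_wpM2r //.
  rewrite /on_parts inE; have := nu_ge0 dense y.
  by case: (part y \in B); rewrite /= ?andbF // andbT; case: ifP.
- move=> x; rewrite inE => /andP[xD xB]; rewrite /typical xB /= -ltNge => badx.
  have lt1 : #|B|%:R * delta < #|B|%:R * \sum_y mu y * (missing col x y)%:R by rewrite ltr_pM2l.
  have le2 : #|B|%:R * \sum_y mu y * (missing col x y)%:R <=
     \sum_y on_parts part nu (B :\: D) y * (missing col x y && (part x != part y))%:R +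
     1 + #|D|%:R.
    rewrite -(sum_on_parts dense D) -[X in _ + X + _](sum_on_part dense (part x)).
    rewrite mulr_sumr -!big_split.
    apply: ler_sum => y _; rewrite mulrA muE /= /on_part /on_parts inE.
    have n0 := nu_ge0 dense y; rewrite [part y == _]eq_sym.
    case: (missing col x y); rewrite /= ?mulr0 ?mulr1 ?add0r; last first.
      by rewrite addr_ge0 //; case: ifP.
    move: (nu y) n0 (part y \in B) (part y \in D) (part x == part y) => v v0 b d p.
    by clear -v0; case: b; case: d; case: p => /=; rewrite ?mulr1 ?mulr0 ?mul0r; lra.
  have : #|B|%:R * beta <= #|B|%:R * (delta / 2) by rewrite ler_wpM2l.
  have : #|B|%:R * e <= #|B|%:R * (delta / 4) by rewrite ler_wpM2l.
  move: lt1 le2; set A := #|B|%:R * \sum_y _; set A' := \sum_y _; lra.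
Qed.

(** * Reaching the structured case *)

Lemma card_fibre_pigeonhole (I T : finType) (f : I -> T) (B : {set I}) (t0 : T) :
  exists t, (#|B| <= #|T| * #|[set i in B | f i == t]|)%N.
Proof.
apply: contrapT => no.
have lt t : (#|T| * #|[set i in B | f i == t]| < #|B|)%N.
  by rewrite ltnNge; apply/negP => h; apply: no; exists t.
have BE : #|B| = (\sum_t #|[set i in B | f i == t]|)%N.
  rewrite -sum1_card (partition_big f predT) //=; apply: eq_bigr => t _.
  by rewrite -sum1_card; apply: eq_bigl => i; rewrite inE.
have : (\sum_(t : T) #|T| * #|[set i in B | f i == t]| < \sum_(t : T) #|B|)%N.
  rewrite (bigD1 t0) // [X in (_ < X)%N](bigD1 t0) //=.
  by rewrite -addSn leq_add // leq_sum // => t _; rewrite ltnW.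
by rewrite -big_distrr /= -BE sum_nat_const ltnn.
Qed.

(** Each such vertex has positive density of (k+1)-cliques in its neighbourhood;
    enough of them have a common neighbourhood containing a complete (k+1)-partite
    graph, which they extend to one with k+2 classes, large enough for H. *)
Lemma few_vertices_meet_all_classes (R : realType) (H : sgraph) k (eps : R) :
  has_edge H -> colourable H k.+2 -> 0 < eps ->
  exists (gam alpha : R) (N : nat), [/\ 0 < gam, 0 < alpha &
  forall (G : sgraph) (mu : G -> R) (col : G -> nat),
    weighting mu -> (forall x, mu x <= alpha) -> ~ contains_copy G H ->
    bil (missing col) mu mu <= gam ->
    (#|[set x : G | [forall c : 'I_k.+1, (eps <= \sum_(y in nbr x | col y == c) mu y)%R]]| < N)%N].
Proof.
move=> eH colH eps0.
have [gam [eta [gam0 eta0 classesP]]] := clique_mass_classes k.+1 eps0.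
have [N [eta' [_ eta'0 pigeonP]]] := common_nbr_clique_mass k.+1 #|H| eta0.
have [alpha [alpha0 blowP]] := clique_mass_blowup k.+1 #|H| eta'0.
exists gam, alpha, N; split=> // G mu col wmu mualpha nocopy mis.
rewrite ltnNge; apply/negP => leN; apply: nocopy; set Y := [set x | _] in leN.
have [mu0 _] := wmu.
have [x xY|S [_ cS etaS]] := pigeonP G mu finset.setT Y wmu leN.
  apply: (classesP G mu col _ (iota 0 k.+1) wmu); rewrite ?size_iota ?iota_uniq //.
    move=> c; rewrite mem_iota add0n => /andP[_ ck]; rewrite setTI.
    by move: xY; rewrite inE => /forallP/(_ (Ordinal ck)).
  apply: le_trans mis; rewrite /bil big_mkcond; apply: ler_sum => y _.
  have m0 z : 0 <= mu y * mu z * ((col y != col z) && ~~ adj y z)%:R.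
    by rewrite !mulr_ge0.
  case: ifP => _; last exact: sumr_ge0.
  by rewrite big_mkcond; apply: ler_sum => z _; case: ifP.
apply: (contains_copy_blowup (B := finset.setT) eH colH); exists S; split=> //.
exact: blowP etaS.
Qed.

(** Stability colours all vertices with few inner edges on average.  To bound the
    inner neighbours of every vertex, discard the parts with a vertex that meets all
    classes substantially, and move each other vertex to a class that it hardly
    meets; a vertex that changes class was missing half a class, so the moved weight
    is small. *)
Lemma near_partite_colouring (R : realType) (H : sgraph) k (eps : R) :
  has_edge H -> colourable H k.+2 -> 0 < eps ->
  exists L : nat, forall (G : sgraph) (I : finType) (part : G -> I) (nu : G -> R),
    dense_parts k part nu -> (L <= #|I|)%N -> ~ contains_copy G H ->
  exists (B : {set I}) (col : G -> nat),
    [/\ (#|I| <= 2 * #|B|)%N, forall x, (col x < k.+1)%N &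
      forall x, part x \in B ->
        \sum_(y | part y \in B) mean_weight part nu finset.setT y * (inner col x y)%:R <= eps].
Proof.
move=> eH colH eps0.
have [Q [Q0 Q1 QE]] := half_fair_share R k.
have [e2 [e20 e2_eps e2_Q]] : exists e2 : R, [/\ 0 < e2, e2 <= eps / 2 & e2 <= Q].
  exists (Num.min (eps / 2) Q).
  by rewrite !ge_min !lexx !orbT; split=> //; rewrite lt_min Q0 andbT; lra.
have [gam [alpha2 [N [gam0 alpha20 fewP]]]] := few_vertices_meet_all_classes eH colH e20.
have [e1 [e10 e1_gam e1_Q e1_e2]] : exists e1 : R,
    [/\ 0 < e1, 3 * e1 <= gam, 3 * e1 <= (Q * 2) ^+ 2 & 3 * e1 <= e2 * Q].
  have P0 : 0 < (Q * 2) ^+ 2 by rewrite exprn_gt0 // mulr_gt0.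
  have P1 : 0 < e2 * Q by rewrite mulr_gt0.
  move: (_ ^+ 2) (e2 * Q) P0 P1 => a b a0 b0.
  exists (Num.min gam (Num.min a b) / 3).
  have -> : 3 * (Num.min gam (Num.min a b) / 3) = Num.min gam (Num.min a b) by lra.
  by rewrite !ge_min !lexx !orbT divr_gt0 // !lt_min gam0 a0.
have [eta [eta0 stabP]] := clique_mass_stability k e10.
have [alpha1 [alpha10 blowP]] := clique_mass_blowup k.+2 #|H| eta0.
have [beta [beta0 b_e1 b_a1 b_a2]] : exists beta : R,
    [/\ 0 < beta, beta <= e1, beta <= alpha1 & beta <= alpha2].
  exists (Num.min e1 (Num.min alpha1 alpha2)).
  by rewrite !ge_min !lexx !orbT !lt_min e10 alpha10 alpha20.
have [L0 [L00 ltL0]] := exists_nat_mul_gt 1 beta0.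
exists (L0 + 2 * N)%N => G I part nu dense leL nocopy.
set mu := mean_weight part nu finset.setT.
have lP : (0 < #|[set: I]|)%N by rewrite cardsT; apply: leq_trans leL; rewrite addn_gt0 L00.
have l0 : 0 < #|[set: I]|%:R :> R by rewrite ltr0n.
have vbeta : #|[set: I]|%:R^-1 <= beta.
  rewrite -[leLHS]mul1r ler_pdivrMr // mulrC; apply: le_trans (ltW ltL0) _.
  by rewrite ler_wpM2r ?(ltW beta0) // ler_nat cardsT (leq_trans (leq_addr _ _) leL).
have wmu : weighting mu by apply: mean_weighting dense _.
have [mu0 mu1] := wmu.
have mu_le x : mu x <= beta by apply: le_trans (mean_weight_le dense _ _) vbeta.
have small : clique_mass mu k.+2 finset.setT <= eta.
  rewrite leNgt; apply/negP => big; apply: nocopy.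
  apply: (contains_copy_blowup (B := finset.setT) eH colH).
  apply: (blowP G mu _ wmu _ (ltW big)) => x; exact: le_trans (mu_le x) b_a1.
have [col0 [col0k stab]] := stabP G mu finset.setT wmu small.
have ins0 : bil (inner col0) mu mu <= 2 * e1.
  have := bil_adj_mean dense lP; rewrite -/mu.
  have : bil (@adj G) mu mu + bil (inner col0) mu mu <= 1 - k.+1%:R^-1 + e1.
    move: stab; have -> : \sum_(x in finset.setT) mu x = 1.
      rewrite -(sum_mean_weight dense lP); apply: eq_bigl => x; exact: in_setT.
    rewrite expr1n mulr1; apply: le_trans; rewrite -big_split.
    apply: le_of_eq; apply: eq_big => x; first by rewrite in_setT.
    move=> _ /=; rewrite -big_split; apply: eq_big => y; first by rewrite in_setT.
    move=> _ /=; rewrite -mulrDr /inner; congr (_ * _).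
    by case: (adj x y); rewrite /= ?mul1r ?mul0r ?addr0.
  set a := k.+1%:R^-1; set b := _^-1 in vbeta *; lra.
have e'P : 2 * e1 + #|[set: I]|%:R^-1 <= 3 * e1 by lra.
have [mis classes] := near_turan dense col0k lP ins0 e'P.
have {}classes c : (c < k.+1)%N -> Q * 2 <= class_mass col0 mu c.
  by rewrite QE in classes; apply: classes.
have few := fewP G mu col0 wmu (fun x => le_trans (mu_le x) b_a2) nocopy
  (le_trans mis e1_gam).
set Y := [set x | _] in few.
pose nbr_mass x c := \sum_(y in nbr x | col0 y == c) mu y.
pose col x : nat := if [pick c : 'I_k.+1 | nbr_mass x c < e2] is Some c then c else col0 x.
have colk x : (col x < k.+1)%N by rewrite /col; case: pickP => [c _|_] //; exact: ltn_ord.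
pose B := ~: [set part x | x in Y].
have colP x : part x \in B -> nbr_mass x (col x) < e2.
  rewrite inE => xB; rewrite /col; case: pickP => [c //|no].
  case/negP: xB; apply: imset_f; rewrite inE; apply/forallP => c.
  by have := no c; rewrite ltNge => /negbFE.
(* A vertex of B that changes class misses weight at least 2Q - e2 >= Q of its new
   class. *)
have wrong : \sum_(y | (part y \in B) && (col y != col0 y)) mu y <= e2.
  rewrite -(ler_pM2r Q0); apply: le_trans e1_e2; apply: le_trans mis.
  rewrite bilE mulr_suml big_mkcond; apply: ler_sum => y _.
  have s0 : 0 <= \sum_z mu z * (missing col0 y z)%:R.
    by apply: sumr_ge0 => z _; rewrite mulr_ge0.
  case: ifP => [/andP[yB yc]|_]; last by rewrite mulr_ge0.
  rewrite ler_wpM2l //; have := colP y yB; have := classes _ (colk y).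
  have : class_mass col0 mu (col y) <= nbr_mass y (col y) + \sum_z mu z * (missing col0 y z)%:R.
    rewrite /class_mass /nbr_mass big_mkcond [X in X + _]big_mkcond -big_split /=.
    apply: ler_sum => z _; rewrite inE /missing.
    have [/eqP ->|_] := boolP (col0 z == col y); last by rewrite andbF add0r mulr_ge0.
    by rewrite [col0 y == _]eq_sym yc; case: (adj y z); rewrite /= ?mulr0 ?mulr1 ?addr0 ?add0r.
  lra.
exists B, col; split=> //.
  have le : (#|[set part x | x in Y]| <= #|Y|)%N := leq_imset_card _ _.
  rewrite cardsCs setCK; move: le few leL.
  move: #|[set part x | x in Y]| #|Y| #|I| => a b c; clear; lia.
move=> x xB; apply: le_trans (_ : nbr_mass x (col x) +
    \sum_(y | (part y \in B) && (col y != col0 y)) mu y <= _); last first.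
  by have := colP x xB; lra.
rewrite /nbr_mass big_mkcond [X in X + _]big_mkcond [X in _ + X]big_mkcond -big_split /=.
apply: ler_sum => y _; rewrite [y \in nbr x]inE /inner.
case: (part y \in B); last by rewrite /= addr0; case: ifP.
case: (adj x y); rewrite /= ?mulr0; last by rewrite add0r; case: ifP.
have [/eqP ->|_] := boolP (col x == col y); last first.
  by rewrite mulr0 addr_ge0 //; case: ifP.
by rewrite eq_sym mulr1; case: eqP; rewrite /= ?addr0 ?add0r.
Qed.

(** Among the parts of [near_partite_colouring], those with the most frequent sign
    pattern of the centred class weights are a fixed fraction of all parts, so the
    bound on inner neighbours survives up to a constant, and vectors with equal sign
    patterns have a non-negative inner product. *)
Lemma dense_parts_copy (R : realType) (H : sgraph) k :
  has_edge H -> almost_colour_critical H -> chromatic_number H = k.+2 ->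
  exists L : nat, forall (G : sgraph) (I : finType) (part : G -> I) (nu : G -> R),
    dense_parts k part nu -> (L <= #|I|)%N -> contains_copy G H.
Proof.
move=> eH acc chi.
have colH : colourable H k.+2.
  by rewrite -chi /chromatic_number; case: ex_minnP.
have [e3 [L3 [e30 structP]]] := structured_parts_copy R eH acc chi.
pose M := #|{ffun 'I_k.+1 -> bool}|.
have M0 : (0 < M)%N by apply/card_gt0P; exists [ffun=> true].
have MR : 0 < M%:R :> R by rewrite ltr0n.
have e0 : 0 < e3 / (2 * M%:R) by rewrite divr_gt0 // mulr_gt0.
have [L nearP] := near_partite_colouring eH colH e0.
exists (L + 2 * M * L3).+1 => G I part nu dense leL; apply: contrapT => nocopy.
have [|B [col [cB colk inner_e]]] := nearP G I part nu dense _ nocopy; first by lia.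
pose q : R := k.+1%:R.
pose sgn i : {ffun 'I_k.+1 -> bool} :=
  [ffun c : 'I_k.+1 => q^-1 <= class_mass col (on_part part nu i) c].
have [s] := card_fibre_pigeonhole sgn B [ffun=> true].
rewrite -/M; set B' := [set i in B | _] => cB'.
apply: nocopy; apply: (structP G I part nu B' col dense _ colk).
- rewrite -(leq_pmul2l M0); lia.
- move=> x; rewrite inE => /andP[xB _].
  have B'0 : (0 < #|B'|)%N by case: (#|B'|) cB' => //; lia.
  have B'R : 0 < #|B'|%:R :> R by rewrite ltr0n.
  have lR : 0 < #|[set: I]|%:R :> R by rewrite cardsT ltr0n; lia.
  apply: le_trans (_ : 2 * M%:R * \sum_(y | part y \in B)
      mean_weight part nu finset.setT y * (inner col x y)%:R <= _); last first.
    by rewrite mulrC -ler_pdivlMr ?mulr_gt0 // inner_e.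
  rewrite mulr_sumr [leRHS]big_mkcond; apply: ler_sum => y _.
  have n0 := nu_ge0 dense y; rewrite /mean_weight /on_parts in_setT inE.
  case: (part y \in B) => /=; last by rewrite !mul0r.
  rewrite mulrA ler_wpM2r // mulrCA; case: ifP => _; last first.
    by rewrite mul0r !mulr_ge0 // invr_ge0.
  rewrite ler_wpM2l // -[leLHS]mul1r ler_pdivrMr // mulrAC ler_pdivlMr // mul1r cardsT.
  by rewrite -!natrM ler_nat; lia.
- move=> i j; rewrite !inE => /andP[_ /eqP si] /andP[_ /eqP sj].
  apply: sumr_ge0 => c _; have := congr1 (fun f : {ffun _ -> _} => f c) si.
  have := congr1 (fun f : {ffun _ -> _} => f c) sj; rewrite !ffunE -/q => <-.
  have [le1|lt1] := leP q^-1 (class_mass col (on_part part nu j) c) => h.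
    by rewrite mulr_ge0 // subr_ge0.
  by rewrite mulr_le0 // subr_le0 ltW // ltNge h.
Qed.

(** * The two theorems *)

Lemma edges_betweenE (R : realType) (G : sgraph) (A B : {set G}) :
  (edges_between A B)%:R = \sum_(x in A) \sum_(y in B) (adj x y)%:R :> R.
Proof.
rewrite /edges_between -sum1_card natr_sum pair_big /= big_mkcond [RHS]big_mkcond.
apply: eq_bigr => -[x y] _; rewrite !inE /=.
by case: (x \in A); case: (y \in B); case: (adj x y).
Qed.

Lemma multipartite_dense_parts (R : realType) (G : sgraph) (l k : nat)
    (V : 'I_l -> {set G}) : multipartite V ->
  (forall i j, i != j -> 1 - k.+1%:R^-1 < edge_density R (V i) (V j)) ->
  exists (part : G -> 'I_l) (nu : G -> R), dense_parts k part nu.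
Proof.
move=> [V0 Vdisj Vcover Vind] dens.
have /fin_all_exists[part partP] : forall x, exists i, x \in V i.
  move=> x; have : x \in \bigcup_i V i by rewrite Vcover in_setT.
  by case/finset.bigcupP => i _ xi; exists i.
have partE x i : (part x == i) = (x \in V i).
  apply/eqP/idP => [<- //|xi]; apply/eqP; apply: contraT => /Vdisj.
  by rewrite -setI_eq0 => /eqP/finset.setP/(_ x); rewrite !inE partP xi.
have cV i : 0 < #|V i|%:R :> R by rewrite ltr0n card_gt0 V0.
exists part, (fun x => #|V (part x)|%:R^-1); split.
- move=> x; rewrite invr_ge0 ler0n /= invf_le1 //.
  by rewrite ler1n card_gt0 V0.
- move=> i; rewrite (eq_bigr (fun=> #|V i|%:R^-1)) => [|x /eqP -> //].
  rewrite (eq_bigl (mem (V i))) => [|x]; last exact: partE.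
  by rewrite sumr_const -[LHS]mulr_natl divff // gt_eqF.
- move=> x y; apply: contraTneq => pxy; apply: (Vind (part x)) => //.
  by rewrite pxy.
- move=> i j /dens; congr (_ < _); rewrite /edge_density edges_betweenE mulr_suml.
  apply: eq_big => x; first by rewrite partE.
  move=> /[dup] xi; rewrite -partE => /eqP ->; rewrite mulr_suml.
  apply: eq_big => y; first by rewrite partE.
  by rewrite -partE => /eqP ->; rewrite invfM mulrC.
Qed.

Lemma partite_density_le (R : realType) (H : sgraph) k :
  has_edge H -> almost_colour_critical H -> chromatic_number H = k.+2 ->
  exists L : nat, forall l, (1 < l)%N -> (L <= l)%N ->
    partite_density R l H <= 1 - k.+1%:R^-1.
Proof.
move=> eH acc chi; have [L LP] := dense_parts_copy R eH acc chi.
exists L => l l1 lL; have [_ minP] := partite_densityP R l1 eH.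
apply: minP => G V GV dens; have [part [nu dense]] := multipartite_dense_parts GV dens.
by apply: (LP G 'I_l part nu dense); rewrite card_ord.
Qed.

Theorem theorem1p3 (R : realType) (H : sgraph) (eH : has_edge H) :
  (~ almost_colour_critical H ->
   forall l : nat, (#|H| <= l)%N ->
     partite_density R l H >=
       ((chromatic_number H)%:R - 2) / ((chromatic_number H)%:R - 1)
       + 1 / (((chromatic_number H)%:R - 1) ^+ 2 * (l%:R - 1) ^+ 2))
  /\
  (almost_colour_critical H ->
   exists C : nat, (0 < C)%N /\
     forall l : nat, (C < l)%N ->
       partite_density R l H =
         ((chromatic_number H)%:R - 2) / ((chromatic_number H)%:R - 1)).
Proof.
have [k chi] := chromatic_number_ge2 eH; rewrite chi.
have -> : k.+2%:R - 2 = k%:R :> R by rewrite -(natrB R (isT : (2 <= k.+2)%N)) subn2.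
have -> : k.+2%:R - 1 = k.+1%:R :> R by rewrite -(natrB R (isT : (1 <= k.+2)%N)) subn1.
split=> [nacc l leHl | acc].
  have l1 : (1 < l)%N.
    have [x [y xy]] := eH; apply: leq_trans leHl; apply/card_gt1P.
    by exists x, y; split=> //; apply: contraTneq xy => ->; rewrite adj_irr.
  case: l l1 {leHl} => [|[|n]] // _.
  have -> : n.+2%:R - 1 = n.+1%:R :> R by rewrite -(natrB R (isT : (1 <= n.+2)%N)) subn1.
  exact: (@partite_density_ge R H n k true).
have [L LP] := partite_density_le R eH acc chi.
exists L.+1; split=> // l ltl; have l1 : (1 < l)%N by apply: leq_trans ltl.
have kE : k%:R / k.+1%:R = 1 - k.+1%:R^-1 :> R.
  have q0 : k.+1%:R != 0 :> R by rewrite pnatr_eq0.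
  by apply: (mulIf q0); rewrite divfK // mulrBl mul1r mulVf // -natr1 addrK.
apply: le_anti; rewrite kE LP //=; last by rewrite ltnW // ltnW.
case: l l1 {ltl} => [|[|n]] // _.
by have := @partite_density_ge R H n k false eH chi; rewrite mul0r addr0 kE; apply.
Qed.
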